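(* Let $n\geq4$. A connected graph $G$ other than $K_2$ contains an induced $n$-cycle if and only if the reduction of $G$ contains an induced $n$-cycle. In particular, for every $m\geq1$, the sibling number and the tuft number have joint symmetric distribution on the set of unlabeled connected chordal graphs with $m$ vertices (chordal graphs being those with no induced cycle on $4$ or more vertices); i.e. $\sum_G x^{s(G)}y^{t(G)}$ over these graphs is symmetric in $x$ and $y$.
   Context: Graphs are finite and simple. A leaf is a vertex of degree one; two distinct vertices are siblings if they have the same closed neighborhood $N[v]=\{v\}\cup N(v)$. The sibling number is $s(G)=\max_v\lvert\{u:N[u]=N[v]\}\rvert-1$ and the tuft number $t(G)$ is the maximal number of leaves adjacent to a single vertex. The reduction of a connected graph other than $K_2$ is obtained by repeatedly removing all leaves and contracting each maximal group of siblings to a single vertex until a graph with neither leaves nor siblings is reached. *)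

(* Defs.v *)
From mathcomp Require Import all_boot all_order all_fingroup.
From mathcomp Require Import boolp.

Set Implicit Arguments.
Unset Strict Implicit.
Unset Printing Implicit Defensive.

Section Graphs.
Variable T : finType.
Implicit Types (e : rel T) (V W : {set T}).

Definition simple_graph e : Prop := symmetric e /\ irreflexive e.

Definition connected_graph e : Prop :=
  0 < #|T| /\ forall x y : T, connect e x y.

Definition is_K2 e : Prop :=
  #|T| = 2 /\ forall x y : T, x != y -> e x y.

(* All notions below are relative to the induced subgraph G[V]. *)
Definition cnbh e V (v : T) : {set T} := [set u in V | (u == v) || e v u].

Definition leaves e V : {set T} := [set v in V | #|[set u in V | e v u]| == 1].

Definition siblings e V (u v : T) : bool :=
  [&& u \in V, v \in V, u != v & cnbh e V u == cnbh e V v].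

Definition has_siblings e V : bool := [exists u, exists v, siblings e V u v].

(* One reduction step on the vertex set of the induced subgraph:
   either remove all leaves, or contract each maximal group of siblings to a
   single vertex (realised by keeping exactly one representative of each
   sibling class; the induced subgraph on representatives is isomorphic to
   the contracted graph). *)
Definition red_step e V V' : Prop :=
  (leaves e V != set0 /\ V' = V :\: leaves e V) \/
  (has_siblings e V /\ V' \subset V /\
   forall v, v \in V -> #|[set u in V' | cnbh e V u == cnbh e V v]| = 1).

Inductive red_reach e : {set T} -> {set T} -> Prop :=
| red_refl V : red_reach e V V
| red_trans V V' W : red_step e V V' -> red_reach e V' W -> red_reach e V W.

Definition is_reduction e W : Prop :=
  red_reach e [set: T] W /\ leaves e W = set0 /\ ~~ has_siblings e W.

Definition induced_cycle e V (n : nat) : Prop :=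
  exists f : 'I_n -> T,
    injective f /\ (forall i, f i \in V) /\
    forall i j : 'I_n, e (f i) (f j) = ((i.+1 %% n == j) || (j.+1 %% n == i)).

Definition chordal e : Prop := forall k, 4 <= k -> ~ induced_cycle e [set: T] k.

Definition sibling_number e : nat :=
  (\max_(v : T) #|[set u | cnbh e [set: T] u == cnbh e [set: T] v]|) - 1.

Definition tuft_number e : nat :=
  \max_(v : T) #|[set u in leaves e [set: T] | e u v]|.

End Graphs.

Definition labgraph (m : nat) := {set 'I_m * 'I_m}.
Definition adj m (E : labgraph m) : rel 'I_m := fun x y => (x, y) \in E.

Definition isomorphic m (E E' : labgraph m) : bool :=
  [exists p : {perm 'I_m}, [forall x, forall y, ((x, y) \in E) == ((p x, p y) \in E')]].

Definition chordal_classes (m a b : nat) : {set {set labgraph m}} :=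
  [set [set H | isomorphic G H] | G in
    [set G : labgraph m | `[< simple_graph (adj G) /\ connected_graph (adj G) /\
        chordal (adj G) /\ sibling_number (adj G) = a /\ tuft_number (adj G) = b >]]].

(* Main.v *)
Require Import Defs.
From mathcomp Require Import all_boot all_order all_fingroup.
From mathcomp Require Import boolp zify.

Set Implicit Arguments.
Unset Strict Implicit.
Unset Printing Implicit Defensive.

(* Part one: for n >= 4 no vertex of an induced n-cycle is a leaf, and no two of its
   vertices are siblings, so every reduction step keeps the cycle up to replacing vertices
   by siblings.

   Part two: count vertex-coloured connected chordal graphs up to isomorphism, the plain
   vertices being those of colour 0. Fix a and b and two fresh colours al, be. In a graph
   without these colours, divide each class of plain siblings into blocks of a+2 vertices,
   each replaced by one al-vertex, until at most a+1 plain ones remain; then recolour to be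
   each plain vertex with at least b+1 plain leaves, deleting b+1 of them. On isomorphism
   classes this is a bijection onto the graphs in which the plain vertices satisfy s <= a and
   t <= b while al- and be-vertices are arbitrary and weigh a+2 and b+2 plain vertices. Doing
   the same with (a, al) and (b, be) exchanged yields the same weight condition. Comparing the
   two decompositions and inducting on the number of plain vertices (all terms that use al or
   be have fewer of them) gives the symmetry of the counts for (<= a, <= b), hence of the exact
   ones. The uncoloured K_2, whose two leaves are also siblings, is the only exception to the
   bijection; it affects only m = 2. *)

(** * Induced cycles and reduction steps *)

Section Cycle.
Variables (n : nat) (n4 : 4 <= n).

Definition cyc_adj (i j : 'I_n) := (i.+1 %% n == j) || (j.+1 %% n == i).

Lemma modS_ord (i : 'I_n) : i.+1 %% n = if i.+1 == n then 0 else i.+1.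
Proof.
case: eqP => [->|ni]; first by rewrite modnn.
by rewrite modn_small //; have := ltn_ord i; lia.
Qed.

(** The modulus is resolved into wrap-around cases so that [lia] can decide adjacency on the
    cycle. *)
Lemma cyc_adjE (i j : 'I_n) : cyc_adj i j =
  [|| (i.+1 == j :> nat), (j.+1 == i :> nat), (i == 0 :> nat) && (j.+1 == n)
    | (j == 0 :> nat) && (i.+1 == n)].
Proof.
rewrite /cyc_adj !modS_ord; have := ltn_ord i; have := ltn_ord j.
by do !case: ifP; lia.
Qed.

Lemma cyc_two_nbrs (i : 'I_n) : exists j k, [/\ j != k, cyc_adj i j & cyc_adj i k].
Proof.
have [i0 li] : 0 < n /\ i < n by split; [lia|].
pose a := if i.+1 == n then 0 else i.+1; pose b := if i == 0 :> nat then n.-1 else i.-1.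
have an : a < n by rewrite /a; case: ifP; lia.
have bn : b < n by rewrite /b; case: ifP; lia.
exists (Ordinal an), (Ordinal bn); rewrite !cyc_adjE -val_eqE /=.
by rewrite /a /b; do 2!case: ifP => /=; split; lia.
Qed.

(** The other neighbour of [i] works: it could be adjacent to [j] only in a triangle. *)
Lemma cyc_dist2 (i j : 'I_n) : cyc_adj i j -> exists2 k, cyc_adj i k && (k != j) & ~~ cyc_adj j k.
Proof.
have li := ltn_ord i; have lj := ltn_ord j.
rewrite cyc_adjE => ij.
(* [a] is the predecessor of [i] if [j] is its successor, and the successor otherwise. *)
pose a := if (i.+1 == j :> nat) || ((j == 0 :> nat) && (i.+1 == n))
  then (if i == 0 :> nat then n.-1 else i.-1) else (if i.+1 == n then 0 else i.+1).
have an : a < n by rewrite /a; do !case: ifP; lia.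
exists (Ordinal an); rewrite !cyc_adjE -?val_eqE /= /a; do !case: ifP => /=; lia.
Qed.
End Cycle.

Section Reduction.
Variables (T : finType) (e : rel T).
Hypotheses (e_sym : symmetric e) (e_irr : irreflexive e).
Variables (n : nat) (n4 : 4 <= n).

Lemma mem_cnbh (V : {set T}) (u v : T) : (u \in cnbh e V v) = (u \in V) && ((u == v) || e v u).
Proof. by rewrite inE. Qed.

(* Twins on an induced cycle would have equal neighbourhoods on the cycle, impossible for [n >= 4]. *)
Lemma cycle_no_siblings (V : {set T}) (f : 'I_n -> T) (i j : 'I_n) :
  (forall i, f i \in V) -> injective f ->
  (forall i j, e (f i) (f j) = cyc_adj i j) ->
  cnbh e V (f i) = cnbh e V (f j) -> i = j.
Proof.
move=> fV f_inj fE Nij; apply/eqP; apply: contraT => nij.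
have : f j \in cnbh e V (f i) by rewrite Nij mem_cnbh fV eqxx.
rewrite mem_cnbh fV (inj_eq f_inj) eq_sym (negbTE nij) /= fE => /(cyc_dist2 n4).
case=> k /andP[ik kj] njk.
have : f k \in cnbh e V (f i) by rewrite mem_cnbh fV fE ik orbT.
by rewrite Nij mem_cnbh fE (negbTE njk) (inj_eq f_inj) (negbTE kj) andbF.
Qed.

Lemma induced_cycleW (V V' : {set T}) : V' \subset V -> induced_cycle e V' n -> induced_cycle e V n.
Proof.
move=> sV [f [f_inj [fV fE]]]; exists f; split=> //; split=> // i.
by apply: (subsetP sV).
Qed.

(** Removing leaves spares the cycle because each of its vertices has two neighbours on it. Under a
    contraction each cycle vertex is replaced by the representative of its sibling class. *)
Lemma red_step_cycle (V V' : {set T}) : red_step e V V' ->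
  (induced_cycle e V n <-> induced_cycle e V' n).
Proof.
case=> [[_ ->]|[_ [sV rep]]]; split; try by apply: induced_cycleW; rewrite ?subsetDl.
- move=> [f [f_inj [fV fE]]]; exists f; split=> //; split=> // i.
  rewrite !inE fV andbT /=.
  have [j [k [jk ij ik]]] := cyc_two_nbrs n4 i.
  apply/negP => /cards1P[x Ex].
  have : f j \in [set x] by rewrite -Ex inE fV fE.
  have : f k \in [set x] by rewrite -Ex inE fV fE.
  rewrite !inE => /eqP<- /eqP /f_inj E.
  by rewrite E eqxx in jk.
- move=> [f [f_inj [fV fE]]].
  have /choice [g gP] : forall i, exists x, x \in V' /\ cnbh e V x = cnbh e V (f i).
    move=> i; have /eqP/cards1P[x Ex] := rep _ (fV i); exists x.
    by have := set11 x; rewrite -{1}Ex inE => /andP[? /eqP].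
  have gV i : g i \in V by have [/(subsetP sV)] := gP i.
  have gN i : cnbh e V (g i) = cnbh e V (f i) by have [] := gP i.
  have no_sib := cycle_no_siblings fV f_inj fE.
  have g_inj : injective g by move=> i j E; apply: no_sib; rewrite -!gN E.
  exists g; split=> //; split=> [i|i j]; first by case: (gP i).
  have [->|nij] := eqVneq i j; first by rewrite e_irr -fE e_irr.
  (* Equality of closed neighbourhoods replaces [g i] by [f i] and then, after exchanging the two
     vertices, [g j] by [f j]. *)
  have E1 : e (g i) (g j) = (g j \in cnbh e V (f i)).
    by rewrite -gN mem_cnbh gV (inj_eq g_inj) eq_sym (negbTE nij).
  have E2 : (f i \in cnbh e V (g j)) = e (f i) (f j).
    by rewrite gN mem_cnbh fV (inj_eq f_inj) (negbTE nij) e_sym.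
  transitivity (e (f i) (f j)); last exact: fE.
  by rewrite E1 -E2 !mem_cnbh gV fV /= eq_sym e_sym.
Qed.

Lemma red_reach_cycle (V W : {set T}) : red_reach e V W ->
  (induced_cycle e V n <-> induced_cycle e W n).
Proof. by elim=> // V1 V2 W1 /red_step_cycle-> . Qed.
End Reduction.

(** * Counting isomorphism classes *)

(** Each element goes to the one at the same position in the enumeration of the corresponding
    fibre. *)
Lemma fiber_inj (U V : finType) (X : eqType) (f : U -> X) (g : V -> X) :
  (forall x, #|[set u | f u == x]| <= #|[set v | g v == x]|) ->
  exists h : U -> V, injective h /\ forall u, g (h u) = f u.
Proof.
move=> le_fg.
(* [v0] only serves as the default of [nth]; an empty [V] forces an empty [U]. *)
case: (pickP (mem [set: V])) => [v0 _|V0]; last first.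
  have U0 (u : U) : False.
    have := le_fg (f u); rewrite [X in _ <= X]eq_card0; last first.
      by move=> v; have := V0 v; rewrite !inE.
    by rewrite leqn0 cards_eq0 => /eqP/setP/(_ u); rewrite !inE eqxx.
  by exists (fun u => match U0 u with end); split=> [u|u]; case: (U0 u).
pose A u := enum [set w | f w == f u].
pose B u := enum [set v | g v == f u].
have ltB u : index u (A u) < size (B u).
  by rewrite (leq_trans _ (_ : size (A u) <= _)) ?index_mem ?mem_enum ?inE // -!cardE.
pose h u := nth v0 (B u) (index u (A u)).
have gh u : g (h u) = f u.
  by have := mem_nth v0 (ltB u); rewrite mem_enum inE => /eqP.
exists h; split=> // u w huw.
have fuw : f u = f w by rewrite -gh huw gh.
have EA : A u = A w by rewrite /A fuw.
have EB : B u = B w by rewrite /B fuw.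
move: huw; rewrite /h EB => /eqP; rewrite nth_uniq ?enum_uniq //; last by rewrite -EB.
rewrite EA => /eqP E.
rewrite -(nth_index u (_ : u \in A w)) ?E ?nth_index //; by rewrite mem_enum inE // fuw.
Qed.

Lemma fiber_bij (U V : finType) (X : eqType) (f : U -> X) (g : V -> X) :
  (forall x, #|[set u | f u == x]| = #|[set v | g v == x]|) ->
  exists h : U -> V, bijective h /\ forall u, g (h u) = f u.
Proof.
move=> eq_fg.
have [h [h_inj gh]] : exists h : U -> V, injective h /\ forall u, g (h u) = f u.
  by apply: fiber_inj => x; rewrite eq_fg.
have [k [k_inj _]] : exists k : V -> U, injective k /\ forall v, f (k v) = g v.
  by apply: fiber_inj => x; rewrite eq_fg.
by exists h; split=> //; apply: inj_card_bij => //; apply: leq_card k_inj.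
Qed.

Section Classes.
Variables (O : Type) (iso : O -> O -> Prop).
Hypotheses (iso_refl : forall x, iso x x)
  (iso_sym : forall x y, iso x y -> iso y x)
  (iso_trans : forall x y z, iso x y -> iso y z -> iso x z).
Implicit Types P Q : O -> Prop.

(** Such an [r] induces a bijection between the [iso]-classes in [P] and those in [Q]. A relation is
    used because expansions and contractions are determined only up to isomorphism. *)
Definition equin P Q : Prop :=
  exists r : O -> O -> Prop,
    [/\ forall x, P x -> exists2 y, Q y & r x y,
        forall y, Q y -> exists2 x, P x & r x y
      & forall x x' y y', P x -> P x' -> Q y -> Q y' -> r x y -> r x' y' ->
          (iso x x' <-> iso y y')].

(** [O] need not be finite, so classes are counted by a finite transversal [f]. *)
Definition ncls P (n : nat) : Prop :=
  exists (I : finType) (f : I -> O),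
    [/\ #|I| = n, forall i, P (f i), forall i j, iso (f i) (f j) -> i = j
      & forall x, P x -> exists i, iso x (f i)].

Lemma equin_refl P : equin P P.
Proof.
exists iso; split=> [x Px|x Px|x x' y y' _ _ _ _ xy x'y'].
- by exists x.
- by exists x.
split=> H.
- exact: iso_trans (iso_trans (iso_sym xy) H) x'y'.
- exact: iso_trans (iso_trans xy H) (iso_sym x'y').
Qed.

Lemma equin_sym P Q : equin P Q -> equin Q P.
Proof.
case=> r [r1 r2 r3]; exists (fun y x => r x y); split=> // y y' x x' Qy Qy' Px Px' ? ?.
by apply: iff_sym; apply: r3.
Qed.

Lemma equin_trans P Q R : equin P Q -> equin Q R -> equin P R.
Proof.
case=> r [r1 r2 r3] [s [s1 s2 s3]].
exists (fun x z => exists y, [/\ Q y, r x y & s y z]); split.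
- by move=> x Px; have [y Qy rxy] := r1 x Px; have [z Rz syz] := s1 y Qy; exists z => //; exists y.
- by move=> z Rz; have [y Qy syz] := s2 z Rz; have [x Px rxy] := r2 y Qy; exists x => //; exists y.
move=> x x' z z' Px Px' Rz Rz' [y [Qy rxy syz]] [y' [Qy' rxy' syz']].
by apply: (iff_trans (r3 _ _ _ _ Px Px' Qy Qy' rxy rxy')); apply: s3.
Qed.

Lemma ncls_unique_le P m n : ncls P m -> ncls P n -> m <= n.
Proof.
move=> [I [f [<- Pf f_inj f_cov]]] [J [g [<- Pg g_inj g_cov]]].
have /choice [h hP] : forall i, exists j, iso (f i) (g j) by move=> i; apply: g_cov.
apply: (@leq_card _ _ h) => i i' E; apply: f_inj; apply: iso_trans (hP i) _.
by rewrite E; apply: iso_sym.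
Qed.

Lemma ncls_unique P m n : ncls P m -> ncls P n -> m = n.
Proof. by move=> Pm Pn; apply/eqP; rewrite eqn_leq !(@ncls_unique_le P). Qed.

Lemma ncls_equin P Q n : equin P Q -> ncls P n -> ncls Q n.
Proof.
move=> [r [r1 r2 r3]] [I [f [cI Pf f_inj f_cov]]].
have /choice [g gP] : forall i, exists y, Q y /\ r (f i) y.
  by move=> i; have [y] := r1 _ (Pf i); exists y.
have Qg i : Q (g i) by case: (gP i).
have rg i : r (f i) (g i) by case: (gP i).
exists I, g; split=> // [i j ij|y Qy].
  by apply: f_inj; apply/(r3 _ _ (g i) (g j)).
have [x Px rxy] := r2 _ Qy; have [i xi] := f_cov _ Px.
by exists i; apply/(r3 x (f i)).
Qed.

Lemma equin_ncls P Q n : ncls P n -> ncls Q n -> equin P Q.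
Proof.
move=> [I [f [cI Pf f_inj f_cov]]] [J [g [cJ Qg g_inj g_cov]]].
have eIJ : #|I| = #|J| by rewrite cI cJ.
have [|h [[k hK kK] _]] := @fiber_bij I J unit (fun=> tt) (fun=> tt).
  by case; rewrite !(eq_card (_ : _ =i predT)) // => i; rewrite inE.
exists (fun x y => exists i, iso x (f i) /\ iso y (g (h i))); split.
- by move=> x Px; have [i xi] := f_cov x Px; exists (g (h i)) => //; exists i.
- move=> y Qy; have [j yj] := g_cov y Qy; exists (f (k j)) => //; exists (k j).
  by rewrite kK.
move=> x x' y y' _ _ _ _ [i [xi yi]] [i' [xi' yi']]; split=> H.
- have E : i = i' by apply: f_inj; apply: iso_trans (iso_sym xi) (iso_trans H xi').
  by subst i'; apply: iso_trans yi (iso_sym yi').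
- have E : h i = h i' by apply: g_inj; apply: iso_trans (iso_sym yi) (iso_trans H yi').
  have {}E : i = i' by rewrite -(hK i) E hK.
  by subst i'; apply: iso_trans xi (iso_sym xi').
Qed.

Lemma ncls_add P Q m n :
  (forall x y, P x -> Q y -> ~ iso x y) -> ncls P m -> ncls Q n ->
  ncls (fun x => P x \/ Q x) (m + n).
Proof.
move=> PQ [I [f [cI Pf f_inj f_cov]]] [J [g [cJ Qg g_inj g_cov]]].
exists (I + J)%type, (fun k => match k with inl i => f i | inr j => g j end); split.
- by rewrite card_sum cI cJ.
- by case=> ?; [left|right].
- move=> [i|j] [i'|j'] H; try by congr (_ _); auto.
  + by case: (PQ _ _ (Pf i) (Qg j') H).
  + by case: (PQ _ _ (Pf i') (Qg j) (iso_sym H)).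
- move=> x [/f_cov[i xi]|/g_cov[j xj]]; first by exists (inl i).
  by exists (inr j).
Qed.

(** The [f i] need not satisfy [P]: [q] selects one index per class, and the classes that meet [P]
    get a representative there. *)
Lemma ncls_finite P (I : finType) (f : I -> O) :
  (forall x, P x -> exists i, iso x (f i)) -> exists n, ncls P n.
Proof.
move=> f_cov.
pose q i := [pick j | `[< iso (f i) (f j) >]].
have qE i j : iso (f i) (f j) -> q i = q j.
  move=> ij; apply: eq_pick => k; apply/asboolP/asboolP => H.
    exact: iso_trans (iso_sym ij) H.
  exact: iso_trans ij H.
have qP i j : q i = Some j -> iso (f i) (f j).
  by rewrite /q; case: pickP => // k /asboolP H [<-].
pose K := {j : I | `[< (exists x, P x /\ iso x (f j)) /\ q j = Some j >]}.
have /choice [g gP] : forall k : K, exists x, P x /\ iso x (f (val k)).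
  by move=> [j Hj] /=; have /asboolP[] := Hj.
exists #|{: K}|, {: K}, g; split=> //.
- by move=> k; case: (gP k).
- move=> k k' H; apply: val_inj.
  have E : q (val k) = q (val k').
    apply: qE; have [_ H1] := gP k; have [_ H2] := gP k'.
    exact: iso_trans (iso_sym H1) (iso_trans H H2).
  move: E; have /asboolP[_ ->] := valP k; have /asboolP[_ ->] := valP k'.
  by case.
move=> x Px; have [i xi] := f_cov x Px.
have [j qj] : exists j, q i = Some j.
  rewrite /q; case: pickP => [j _|/(_ i)]; first by exists j.
  by move/asboolP; case.
have ij := qP _ _ qj.
have xj : iso x (f j) := iso_trans xi ij.
have Hj : `[< (exists x, P x /\ iso x (f j)) /\ q j = Some j >].
  by apply/asboolP; split; [exists x|rewrite -(qE _ _ ij)].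
by exists (exist _ j Hj); have [_ H] := gP (exist _ j Hj); apply: iso_trans xj (iso_sym H).
Qed.

Lemma ncls_sub P Q n : (forall x, Q x -> P x) -> ncls P n -> exists m, ncls Q m.
Proof.
move=> QP [I [f [_ _ _ f_cov]]].
by apply: (@ncls_finite _ I f) => x /QP; apply: f_cov.
Qed.

(** Subtraction of bijections: the parts of index other than [i0] are glued together, and by
    finiteness their number cancels from the common total. *)
Lemma equin_index P Q (I : Type) (f g : O -> I) (i0 : I) n :
  (forall x y, iso x y -> P x -> P y -> f x = f y) ->
  (forall x y, iso x y -> Q x -> Q y -> g x = g y) ->
  ncls P n -> equin P Q ->
  (forall i, i <> i0 -> equin (fun x => P x /\ f x = i) (fun x => Q x /\ g x = i)) ->
  equin (fun x => P x /\ f x = i0) (fun x => Q x /\ g x = i0).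
Proof.
move=> f_iso g_iso Pn PQ PQi.
have Qn := ncls_equin PQ Pn.
pose P' x := P x /\ f x <> i0; pose Q' x := Q x /\ g x <> i0.
have PQ' : equin P' Q'.
  have /choice [r rP] : forall i : I, exists r : O -> O -> Prop, i <> i0 ->
      [/\ forall x, P x /\ f x = i -> exists2 y, Q y /\ g y = i & r x y,
          forall y, Q y /\ g y = i -> exists2 x, P x /\ f x = i & r x y
        & forall x x' y y', P x /\ f x = i -> P x' /\ f x' = i ->
            Q y /\ g y = i -> Q y' /\ g y' = i -> r x y -> r x' y' ->
            (iso x x' <-> iso y y')].
    move=> i; case: (pselect (i = i0)) => [->|ni]; first by exists (fun _ _ => True).
    by have [r rP] := PQi _ ni; exists r.
  exists (fun x y => f x = g y /\ r (f x) x y); split.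
  - move=> x [Px fx]; have [r1 _ _] := rP _ fx.
    have [//|y [Qy gy] rxy] := r1 x.
    by exists y; split=> //; rewrite gy.
  - move=> y [Qy gy]; have [_ r2 _] := rP _ gy.
    have [//|x [Px fx] rxy] := r2 y.
    by exists x; split=> //; rewrite fx.
  - move=> x x' y y' [Px fx] [Px' fx'] [Qy gy] [Qy' gy'] [E r1] [E' r2].
    have [_ _ r3] := rP _ fx.
    have [ff|nff] := pselect (f x = f x').
      by apply: r3 => //; rewrite ?ff -?E -?E' -?ff //; rewrite ff.
    split=> H; case: nff; first exact: f_iso.
    by rewrite E E'; apply: g_iso.
have [n1 Pn1] : exists m, ncls (fun x => P x /\ f x = i0) m.
  by apply: ncls_sub Pn => x [].
have [n2 Pn2] : exists m, ncls P' m by apply: ncls_sub Pn => x [].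
have [m1 Qm1] : exists m, ncls (fun x => Q x /\ g x = i0) m.
  by apply: ncls_sub Qn => x [].
have Qn2 := ncls_equin PQ' Pn2.
have En : n = n1 + n2.
  apply: (@ncls_unique P) => //.
  have -> : P = (fun x => (P x /\ f x = i0) \/ P' x).
    apply/funext => x; apply/propext; split=> [Px|]; last by case=> [][].
    by have [fx|fx] := pselect (f x = i0); [left|right].
  apply: ncls_add => // x y [Px fx] [Py fy] xy; apply: fy.
  by rewrite -fx; apply: f_iso => //; apply: iso_sym.
have Em : n = m1 + n2.
  apply: (@ncls_unique Q) => //.
  have -> : Q = (fun x => (Q x /\ g x = i0) \/ Q' x).
    apply/funext => x; apply/propext; split=> [Px|]; last by case=> [][].
    by have [fx|fx] := pselect (g x = i0); [left|right].
  apply: ncls_add => // x y [Px fx] [Py fy] xy; apply: fy.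
  by rewrite -fx; apply: g_iso => //; apply: iso_sym.
apply: (@equin_ncls _ _ n1) => //.
by have -> : n1 = m1 by lia.
Qed.

End Classes.

(** * Coloured graphs and expansions *)

(* Colour 0 marks the plain vertices. *)
Record cgraph := CGraph { vert :> finType; edge : rel vert; colr : vert -> nat }.
Arguments edge {c}.
Arguments colr {c}.
Implicit Types G K : cgraph.

Definition giso G K : Prop := exists f : G -> K,
  [/\ bijective f, forall u v, edge (f u) (f v) = edge u v
    & forall u, colr (f u) = colr u].

Lemma giso_refl G : giso G G.
Proof. by exists id; split=> //; exists id. Qed.

Lemma giso_sym G K : giso G K -> giso K G.
Proof.
case=> f [[g fK gK] fe fc]; exists g; split; first by exists f.
- by move=> u v; rewrite -fe !gK.
- by move=> u; rewrite -fc gK.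
Qed.

Lemma giso_trans G K H : giso G K -> giso K H -> giso G H.
Proof.
case=> f [fb fe fc] [g [gb ge gc]]; exists (g \o f); split; first exact: bij_comp.
- by move=> u v /=; rewrite ge fe.
- by move=> u /=; rewrite gc fc.
Qed.

Definition good G : Prop :=
  [/\ simple_graph (@edge G), connected_graph (@edge G) & chordal (@edge G)].

(** The content, an isomorphism invariant by which all counts below are graded. *)
Definition cont G (k : nat) : nat := #|[set v : G | colr v == k]|.

(* For [k = true]: u is a sibling of v; for [k = false]: u is a leaf hanging from v. *)
Definition attached (k : bool) G (u v : G) : bool :=
  (u != v) && [forall y, edge u y ==
     if k then (y != u) && ((y == v) || edge v y) else y == v].

Definition mates (k : bool) G (v : G) : {set G} :=
  [set u | (colr u == 0) && attached k u v].

Definition sparse (k : bool) (n : nat) G : Prop :=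
  forall v : G, colr v = 0 -> #|mates k v| < n.

(** [pi] sends each vertex to the vertex of [K] whose block it lies in; [io] singles out one vertex
    of each block. *)
Definition main G K (io : K -> G) (pi : G -> K) (u : G) : bool := u == io (pi u).

(** A block is a clique for [k = true] and a star around its main vertex for [k = false]. An edge of
    [K] joins all pairs between the two blocks in the first case, only their main vertices in the
    second. *)
Definition expn_adj (k : bool) G K (io : K -> G) (pi : G -> K) (u v : G) : bool :=
  if pi u == pi v then (u != v) && [|| k, main io pi u | main io pi v]
  else edge (pi u) (pi v) && (k || main io pi u && main io pi v).

Definition fib G K (pi : G -> K) (v : K) : {set G} := [set u | pi u == v].

(* G arises from K by turning each vertex of colour al into a plain vertex with n further plain
   vertices attached to it, as siblings if [k = true] and as leaves if [k = false]. *)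
Record expansion (k : bool) (n al : nat) G K (io : K -> G) (pi : G -> K) : Prop := Expansion {
  exp_irr : irreflexive (@edge K);
  exp_ioK : cancel io pi;
  exp_adj : forall u v, edge u v = expn_adj k io pi u v;
  exp_fib : forall v, #|fib pi v| = if colr v == al then n.+1 else 1;
  exp_col : forall u, colr u = if colr (pi u) == al then 0 else colr (pi u) }.

Definition expands k n al G K := exists io pi, @expansion k n al G K io pi.

Definition expand_cont (al n : nat) (c : nat -> nat) : nat -> nat := fun j =>
  if j == 0 then c 0 + n.+1 * c al else if j == al then 0 else c j.

Lemma giso_cont G K : giso G K -> cont G = cont K.
Proof.
case=> f [[g fK gK] _ fc]; apply/funext => k; rewrite /cont.
rewrite -(card_imset _ (can_inj fK)); apply: eq_card => v.
apply/imsetP/idP => [[u]|]; rewrite !inE; first by move=> ? ->; rewrite fc.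
by move=> cv; exists (g v); rewrite ?gK // inE -fc gK.
Qed.

Lemma path_map_connect (T U : finType) (e : rel T) (e' : rel U) (f : T -> U) x y :
  (forall u v, e u v -> connect e' (f u) (f v)) ->
  connect e x y -> connect e' (f x) (f y).
Proof.
move=> fe /connectP[p]; elim: p x => [x _ ->|z p IH x] /=; first exact: connect0.
by move=> /andP[xz zp] yE; apply: connect_trans (fe _ _ xz) (IH _ zp yE).
Qed.

Lemma induced_chordal (T U : finType) (e : rel T) (e' : rel U) (f : T -> U) :
  injective f -> (forall u v, e' (f u) (f v) = e u v) -> chordal e' -> chordal e.
Proof.
move=> f_inj fe ch k k4 [g [g_inj [_ gE]]]; apply: (ch k k4).
exists (f \o g); split; first exact: inj_comp.
by split=> [i|i j]; rewrite ?inE //= fe gE.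
Qed.

Lemma giso_good G K : giso G K -> good G -> good K.
Proof.
move=> /[dup] iGK /giso_sym [f [[g fK gK] fe fc]] [[s i] [c0 c] ch]; split.
- by split=> [u v|u]; rewrite -fe ?i // s fe.
- split; first by rewrite -(bij_eq_card (Bijective gK fK)).
  move=> x y; rewrite -(fK x) -(fK y); apply: (@path_map_connect _ _ (@edge G)) (c _ _).
  by move=> u v uv; apply: connect1; rewrite -fe !gK.
- exact: induced_chordal (can_inj fK) fe ch.
Qed.

Lemma giso_sparse k n G K : giso G K -> sparse k n G -> sparse k n K.
Proof.
move=> /giso_sym[f [[g fK gK] fe fc]] spG v cv.
apply: leq_trans (spG (f v) _); last by rewrite fc.
rewrite ltnS -(card_imset _ (can_inj fK)); apply: subset_leq_card.
apply/subsetP => w /imsetP[u]; rewrite !inE => /andP[cu /andP[uv /forallP au]] ->.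
rewrite fc cu /attached (can_eq fK) uv; apply/forallP => y.
by rewrite -[y]gK !fe !(can_eq fK); apply: au.
Qed.

Lemma expands_gisoL k n al G G' K : giso G G' -> expands k n al G K -> expands k n al G' K.
Proof.
case=> f [[g fK gK] fe fc] [io [pi [irr ioK adj fibE colE]]].
exists (f \o io), (pi \o g); split=> //.
- by move=> v /=; rewrite fK.
- move=> u v; rewrite -[u]gK -[v]gK fe adj /expn_adj /main /= !fK.
  by rewrite !(can_eq fK).
- move=> v; rewrite -fibE -(card_imset _ (can_inj fK)); apply: eq_card => u.
  apply/idP/imsetP; rewrite !inE /=.
    by move=> uv; exists (g u); rewrite ?gK // inE.
  by case=> w; rewrite inE => wv ->; rewrite fK.
- by move=> u; rewrite -[u]gK fc colE /= fK.
Qed.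

Lemma expands_gisoR k n al G K K' : giso K K' -> expands k n al G K -> expands k n al G K'.
Proof.
case=> f [[g fK gK] fe fc] [io [pi [irr ioK adj fibE colE]]].
exists (io \o g), (f \o pi); split.
- by move=> v; rewrite -[v]gK fe irr.
- by move=> v /=; rewrite ioK gK.
- move=> u v; rewrite adj /expn_adj /main /= !fK fe.
  by rewrite !(can_eq fK).
- move=> v; rewrite -[v]gK fc -fibE; apply: eq_card => u.
  by rewrite !inE /= (can_eq fK).
- by move=> u; rewrite colE /= fc.
Qed.

(** * Adjacency, content and chordality of an expansion *)

Section Expansion.
Variables (k : bool) (n al : nat) (G K : cgraph) (io : K -> G) (pi : G -> K).
Hypothesis E : expansion k n al io pi.
Let ioK := exp_ioK E.
Let adj := exp_adj E.

Lemma main_io v : main io pi (io v).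
Proof. by rewrite /main ioK. Qed.

Lemma exp_edge_io u v : edge (io u) (io v) = edge u v.
Proof.
rewrite adj /expn_adj !main_io !ioK.
by have [->|_] := eqVneq u v; rewrite ?eqxx ?(exp_irr E) ?orbT ?andbT.
Qed.

Lemma fib_nonal v u : colr v != al -> pi u = v -> u = io v.
Proof.
move=> cv uv; have := exp_fib E v; rewrite (negbTE cv) => /eqP/cards1P[x Ex].
have : u \in fib pi v by rewrite inE uv.
have : io v \in fib pi v by rewrite inE ioK.
by rewrite Ex !inE => /eqP-> /eqP.
Qed.

Lemma main_nonal u : colr (pi u) != al -> main io pi u.
Proof. by move=> c; rewrite /main -(fib_nonal c (erefl _)). Qed.

Hypothesis al0 : al != 0.

(** Block sizes are summed over the blocks that satisfy [C]. Taking all blocks gives the content;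
    sibling classes are counted by another choice of [C]. *)
Lemma exp_count (C : pred K) j :
  #|[set u | C (pi u) & colr u == j]| =
  if j == 0 then #|[set v | C v & colr v == 0]| + n.+1 * #|[set v | C v & colr v == al]|
  else if j == al then 0 else #|[set v | C v & colr v == j]|.
Proof.
have cnt (D : pred K) (B : {set G}) : (forall u, (u \in B) = D (pi u)) ->
    #|B| = \sum_(v | D v) (if colr v == al then n.+1 else 1).
  move=> BD; rewrite -sum1_card (partition_big pi D) /=; last by move=> u; rewrite BD.
  apply: eq_bigr => v Dv; rewrite -(exp_fib E) -sum1_card; apply: eq_bigl => u.
  by rewrite inE BD; case: eqP => [->|]; rewrite ?Dv ?andbF.
have [->|j0] := eqVneq j 0.
  rewrite (cnt (fun v => C v && ((colr v == 0) || (colr v == al)))); last first.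
    move=> u; rewrite inE (exp_col E); congr (_ && _).
    by case: (eqVneq (colr (pi u)) al); rewrite ?orbT ?orbF ?eqxx.
  rewrite (bigID (fun v => colr v == al)) /= addnC; congr (_ + _).
    rewrite -sum1_card; apply: eq_big => [v|v /andP[_ /negbTE->]] //.
    rewrite inE; case: (C v) => //=; case: (eqVneq (colr v) al) => [->|na].
      by rewrite orbT (negbTE al0).
    by rewrite orbF andbT.
  rewrite mulnC -sum_nat_const; apply: eq_big => [v|v /andP[_ ->]] //.
  by rewrite inE -andbA; congr (_ && _); rewrite andb_idl // => ->; rewrite orbT.
rewrite (cnt (fun v => [&& C v, colr v == j & j != al])); last first.
  move=> u; rewrite inE (exp_col E); case: (C _) => //=.
  case: (eqVneq (colr (pi u)) al) => [->|na].
    by rewrite eq_sym (negbTE j0) eq_sym andbN.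
  by case: eqVneq => // <-; rewrite na.
have [->|ja] := eqVneq j al.
  by rewrite big_pred0 // => v; rewrite !andbF.
rewrite -sum1_card; apply: eq_big => [v|v /and3P[_ /eqP-> _]]; first by rewrite inE andbT.
by rewrite (negbTE ja).
Qed.

Lemma exp_cont : cont G = expand_cont al n (cont K).
Proof.
apply/funext => j; have /= := exp_count xpredT j.
by rewrite /cont /expand_cont => ->.
Qed.

(** [io] embeds [K] as an induced subgraph, which inherits chordality; [pi] maps an edge to an edge
    or to a single vertex, so paths descend. *)
Lemma exp_good_contr : good G -> good K.
Proof.
move=> [[s i] [c0 c] ch].
have eio := exp_edge_io.
split.
- by split=> [u v|]; [rewrite -!eio s|exact: (exp_irr E)].
- split.
    have /card_gt0P[u _] := c0.
    by apply/card_gt0P; exists (pi u).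
  move=> u v; rewrite -(ioK u) -(ioK v); apply: path_map_connect (c _ _) => x y.
  rewrite adj /expn_adj; case: eqVneq => [-> _|_ /andP[xy _]]; first exact: connect0.
  exact: connect1.
- exact: induced_chordal (can_inj ioK) eio ch.
Qed.

Lemma exp_sym : symmetric (@edge K) -> symmetric (@edge G).
Proof.
move=> s u v; rewrite !adj /expn_adj eq_sym [v == u]eq_sym s.
by congr (if _ then _ && _ else _ && _); [rewrite [main _ _ _ || _]orbC|rewrite andbC].
Qed.

Lemma edge_to_main u : edge u (io (pi u)) = ~~ main io pi u.
Proof. by rewrite adj /expn_adj ioK eqxx main_io !orbT andbT. Qed.

(** A non-main vertex is a sibling of, or a leaf at, the main vertex of its block. *)
Lemma edge_nonmain u v : ~~ main io pi u ->
  edge u v = if k then (v != u) && ((v == io (pi u)) || edge (io (pi u)) v)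
             else v == io (pi u).
Proof.
move=> mu; rewrite !adj /expn_adj ioK main_io (negbTE mu).
have [Euv|nE] := eqVneq (pi u) (pi v).
  rewrite orbT andbT [io _ == v]eq_sym /main -Euv [v == u]eq_sym; case: k => /=.
    by rewrite orbN.
  by rewrite andb_idl // => /eqP->.
rewrite /= orbF; have -> : (v == io (pi u)) = false.
  by apply/eqP => Ev; rewrite Ev ioK eqxx in nE.
case: k; rewrite ?andbF //= ?andbT.
by case: eqVneq => // Ev; rewrite Ev eqxx in nE.
Qed.

Lemma exp_connected : symmetric (@edge K) ->
  connected_graph (@edge K) -> connected_graph (@edge G).
Proof.
move=> /exp_sym s [/card_gt0P[v0 _] c]; split; first by apply/card_gt0P; exists (io v0).
have to_main u : connect edge u (io (pi u)).
  have [/eqP<-|mu] := boolP (main io pi u); first exact: connect0.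
  by apply: connect1; rewrite edge_to_main.
move=> u v; apply: connect_trans (to_main u) _; rewrite (sym_connect_sym s).
apply: connect_trans (to_main v) _; apply: path_map_connect (c _ _) => x y xy.
by apply: connect1; rewrite exp_edge_io.
Qed.

(** As for reductions, a long induced cycle contains neither siblings nor leaves. So it meets each
    block at most once if [k = true], and consists of main vertices if [k = false]; either way it
    projects to [K]. *)
Lemma exp_chordal : symmetric (@edge K) -> chordal (@edge K) -> chordal (@edge G).
Proof.
move=> s ch m m4 [f [f_inj [_ fE]]]; apply: (ch _ m4).
have sG := exp_sym s.
have [k1|k0] := boolP k.
  have noE i j : pi (f i) = pi (f j) -> i = j.
    move=> Eij; apply/eqP; apply: contraT => nij.
    have Hij : cyc_adj i j.
      by rewrite /cyc_adj -fE adj /expn_adj Eij eqxx k1 /= andbT (inj_eq f_inj).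
    have [l /andP[il lj] njl] := cyc_dist2 m4 Hij.
    move: il njl; rewrite /cyc_adj -!fE !adj /expn_adj Eij k1 /= !andbT !(inj_eq f_inj).
    by case: ifP; [rewrite [j == l]eq_sym lj|move=> _ ->].
  exists (pi \o f); split=> [i j /noE //|]; split=> [i|i j]; first by rewrite inE.
  rewrite -fE adj /expn_adj k1 /= !andbT.
  have [Eij|//] := eqVneq (pi (f i)) (pi (f j)).
  by rewrite (noE _ _ Eij) (exp_irr E) eqxx.
have mf m0 : main io pi (f m0).
  apply: contraT => mi; have [j [l [jl]]] := cyc_two_nbrs m4 m0.
  rewrite /cyc_adj -!fE !(edge_nonmain _ mi) (negbTE k0) => /eqP E1 /eqP E2.
  by case/eqP: jl; apply: f_inj; rewrite E1 E2.
have fio i : f i = io (pi (f i)) by apply/eqP; apply: mf.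
exists (pi \o f); split=> [i j Eij|]; first by apply: f_inj; rewrite (fio i) (fio j) [pi (f i)]Eij.
split=> [i|i j]; first by rewrite inE.
by rewrite -fE -exp_edge_io -!fio.
Qed.

Lemma exp_good : good K -> good G.
Proof.
move=> [[s i] c ch]; split; last exact: exp_chordal.
  split; first exact: exp_sym.
  by move=> u; rewrite adj /expn_adj !eqxx.
exact: exp_connected.
Qed.

End Expansion.

(** * Building and contracting expansions *)

(** The vertices are pairs [(v, i)] with [i] at most [n], where [i = 0] unless [v] has colour [al];
    the pairs [(v, 0)] are the main vertices. *)
Lemma expands_exists k n al K : irreflexive (@edge K) -> exists G, expands k n al G K.
Proof.
move=> irr.
pose T : finType := {x : K * 'I_n.+1 | (x.2 == ord0) || (colr x.1 == al)}.
pose pi (u : T) : K := (val u).1.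
have io0 (v : K) : ((v, ord0 : 'I_n.+1).2 == ord0) || (colr (v, ord0 : 'I_n.+1).1 == al) by [].
pose io (v : K) : T := exist _ (v, ord0) (io0 v).
pose m (u : T) := u == io (pi u).
pose e (u v : T) := if pi u == pi v then (u != v) && [|| k, m u | m v]
  else edge (pi u) (pi v) && (k || m u && m v).
pose c (u : T) := if colr (pi u) == al then 0 else colr (pi u).
exists (CGraph e c), io, pi; split=> // v.
have inj2 : {in fib (G := CGraph e c) pi v &, injective (fun u : T => (val u).2)}.
  move=> x y; rewrite !inE => /eqP xv /eqP yv xy; apply: val_inj.
  by rewrite [val x]surjective_pairing [val y]surjective_pairing -/(pi x) xv -/(pi y) yv xy.
rewrite -(card_in_imset inj2).
have -> : (fun u : T => (val u).2) @: fib (G := CGraph e c) pi v =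
    [set i : 'I_n.+1 | (i == ord0) || (colr v == al)].
  apply/setP => i; rewrite inE; apply/imsetP/idP.
    by case=> u; rewrite inE => /eqP <- ->; apply: valP u.
  by move=> Hi; exists (exist _ (v, i) Hi) => //; rewrite inE.
case: ifP => _.
  by rewrite (_ : [set _ | _] = setT) ?cardsT ?card_ord //; apply/setP => i; rewrite !inE orbT.
by rewrite (_ : [set _ | _] = [set ord0]) ?cards1 //; apply/setP => i; rewrite !inE orbF.
Qed.

Lemma exp_fib_main k n al G K (io : K -> G) (pi : G -> K) v b :
  expansion k n al io pi ->
  #|[set u | (pi u, main io pi u) == (v, b)]| =
  if b then 1 else if colr v == al then n else 0.
Proof.
move=> E; have ioK := exp_ioK E; case: b.
  rewrite (_ : [set _ | _] = [set io v]) ?cards1 //; apply/setP => u.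
  rewrite !inE xpair_eqE eqb_id /main; apply/andP/eqP => [[/eqP<- /eqP]|->] //.
  by rewrite ioK.
have -> : [set u | (pi u, main io pi u) == (v, false)] = fib pi v :\ io v.
  apply/setP => u; rewrite !inE xpair_eqE eqbF_neg /main andbC.
  by have [->|] := eqVneq (pi u) v; rewrite ?andbF.
have := cardsD1 (io v) (fib pi v); rewrite inE ioK eqxx (exp_fib E).
by case: ifP => _ /eqP; lia.
Qed.

(** Colours, and adjacency of distinct vertices, depend only on the labels [(pi u, main io pi u)],
    so a bijection that keeps these labels is an isomorphism. *)
Lemma expands_uniqueL k n al G G' K :
  expands k n al G K -> expands k n al G' K -> giso G G'.
Proof.
move=> [io [pi E]] [io' [pi' E']].
have [x|h [h_bij hE]] := @fiber_bij G G' _ (fun u => (pi u, main io pi u))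
  (fun u => (pi' u, main io' pi' u)).
  by case: x => v b; rewrite !(exp_fib_main _ _ E) !(exp_fib_main _ _ E').
have pih u : pi' (h u) = pi u by case: (hE u).
have mh u : main io' pi' (h u) = main io pi u by case: (hE u).
exists h; split=> // [u v|u].
  by rewrite (exp_adj E) (exp_adj E') /expn_adj !pih !mh (bij_eq h_bij).
by rewrite (exp_col E) (exp_col E') pih.
Qed.

(** The vertex [v] and its [n] mates in [B] merge into one [al]-vertex. Since [K] may already be a
    contraction of [G], the new maps extend the old ones. *)
Lemma expands_contract k n al G K (v : K) (B : {set K}) : al != 0 ->
  symmetric (@edge K) -> expands k n al G K -> colr v = 0 ->
  B \subset mates k v -> #|B| = n ->
  exists K', expands k n al G K' /\ #|K| = #|K'| + n.
Proof.
move=> al0 s [io [pi E]] cv sB cB; have ioK := exp_ioK E; have adj := exp_adj E.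
have cal : colr v != al by rewrite cv eq_sym.
have cB0 x : x \in B -> colr x != al.
  by move/(subsetP sB); rewrite inE => /andP[/eqP-> _]; rewrite eq_sym.
have aB x y : x \in B -> edge x y =
    if k then (y != x) && ((y == v) || edge v y) else y == v.
  by move/(subsetP sB); rewrite inE => /and3P[_ _ /forallP/(_ y)/eqP].
have vB : v \notin B.
  by apply/negP => /(subsetP sB); rewrite inE /attached eqxx andbF.
pose T : finType := {x : K | x \notin B}.
pose v' : T := exist _ v vB.
pose e (x y : T) := edge (val x) (val y).
pose c (x : T) := if x == v' then al else colr (val x).
pose io' (x : T) := io (val x).
(* The default of [insubd] performs the merging: whatever lies over [B] is sent to [v']. *)
pose pi' (u : G) : T := insubd v' (pi u).
have vpi u : val (pi' u) = if pi u \in B then v else pi u.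
  by rewrite val_insubd; case: (pi u \in B).
pose K' := CGraph e c.
have mE u : main (K := K') io' pi' u = main io pi u && (pi u \notin B).
  rewrite /main /io' vpi; case: ifP => pB; rewrite ?andbT ?andbF //.
  by apply/eqP => uE; move: pB; rewrite uE ioK (negbTE vB).
have mnB u : pi u \in B -> main io pi u by move=> /cB0/(main_nonal E).
have mnv u : pi u = v -> main io pi u by move=> uv; apply: (main_nonal E); rewrite uv.
exists K'; split; last first.
  by rewrite card_sig -cB -(cardsC B) addnC; congr (_ + _); apply: eq_card => x; rewrite !inE.
exists io', pi'; split.
- by move=> x; apply: (exp_irr E).
- by move=> x; apply: val_inj; rewrite vpi ioK (negbTE (valP x)).
- have half u w : pi u \in B -> pi w \notin B -> edge u w = expn_adj (K := K') k io' pi' u w.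
    move=> uB wB; rewrite adj /expn_adj !mE -val_eqE /= /e !vpi uB (negbTE wB).
    rewrite (mnB _ uB) andbF andbT /=; have -> : (pi u == pi w) = false.
      by apply/eqP => uw; rewrite uw (negbTE wB) in uB.
    have nuw : u != w by apply/eqP => uw; rewrite uw (negbTE wB) in uB.
    rewrite (aB _ _ uB) nuw eq_sym; have [/esym wv|nvw] := eqVneq v (pi w).
      rewrite mnv //= orbT andbT; case: (k) => //=.
      by rewrite andbT; apply/eqP => E1; rewrite E1 (negbTE wB) in uB.
    case: (k) => /=; rewrite ?(andbT, andbF) //.
    by rewrite andb_idl // => _; apply/eqP => E1; rewrite -E1 uB in wB.
  have symE' u w : expn_adj (K := K') k io' pi' u w = expn_adj (K := K') k io' pi' w u.
    rewrite /expn_adj eq_sym [w == u]eq_sym /= /e s.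
    by congr (if _ then _ && _ else _ && _); [rewrite [main _ _ _ || _]orbC|rewrite andbC].
  move=> u w; have [uB|uB] := boolP (pi u \in B); have [wB|wB] := boolP (pi w \in B).
  + rewrite adj /expn_adj !mE -val_eqE /= /e !vpi uB wB eqxx !andbF !orbF.
    rewrite !mnB //= !orbT !andbT; have [uw|nuw] := eqVneq (pi u) (pi w).
      have -> : u = w.
        by rewrite (fib_nonal E (cB0 _ uB) (erefl _)) (fib_nonal E (cB0 _ wB) (erefl _)) uw.
      by rewrite eqxx.
    have -> : u != w by apply: contra nuw => /eqP->.
    have := aB _ v wB; rewrite eqxx; have nv x : x \in B -> v != x.
      by move=> xB; apply/eqP => vx; rewrite -vx (negbTE vB) in xB.
    rewrite (aB _ _ uB) [pi w == pi u]eq_sym nuw [pi w == v]eq_sym (negbTE (nv _ wB)) s.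
    by case: (k) => // ->; rewrite nv.
  + exact: half.
  + by rewrite (exp_sym E s) half.
  + rewrite adj /expn_adj !mE -val_eqE /= /e !vpi (negbTE uB) (negbTE wB).
    by rewrite !andbT.
- move=> x; rewrite /= /c; have [->|nx] := eqVneq x v'.
    rewrite eqxx.
    (* The old blocks of [v] and of the vertices in [B] are single vertices, none of them having
       colour [al], so the new block has [n.+1] vertices. *)
    have -> : fib (K := K') pi' v' = io @: (v |: B).
      apply/setP => u; rewrite inE -val_eqE vpi /=; apply/idP/imsetP.
        case: ifP => [uB _|_ /eqP uv]; exists (pi u); rewrite ?inE ?uB ?uv ?eqxx ?orbT //.
          exact/eqP/mnB.
        by rewrite -uv; apply/eqP/mnv.
      by case=> y; rewrite !inE => yB ->; rewrite ioK; case: ifP yB => //= _; rewrite ?orbF ?eqxx.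
    by rewrite (card_imset _ (can_inj ioK)) cardsU1 vB cB.
  rewrite -(exp_fib E); apply: eq_card => u; rewrite !inE -val_eqE vpi.
  have nxv : val x != v by apply: contra nx => /eqP xv; apply/eqP/val_inj.
  case: ifP => // uB; rewrite eq_sym (negbTE nxv); apply/esym/eqP => ux.
  by have := valP x; rewrite -ux uB.
- move=> u; rewrite (exp_col E) /= /c -val_eqE vpi /=.
  have [uB|uB] := boolP (pi u \in B).
    rewrite !eqxx; move/(subsetP sB): (uB); rewrite inE => /andP[/eqP-> _].
    by case: ifP.
  have [->|//] := eqVneq (pi u) v; first by rewrite (negbTE cal) eqxx cv.
Qed.

(** * Uniqueness of the sparse contraction *)

Lemma expands_refl k n al G : irreflexive (@edge G) -> cont G al = 0 -> expands k n al G G.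
Proof.
move=> irr /eqP; rewrite cards_eq0 => /eqP/setP cal.
have nal (u : G) : (colr u == al) = false by have := cal u; rewrite !inE.
exists id, id; split=> // [u v|v|u]; last by rewrite nal.
  rewrite /expn_adj /main !eqxx !orbT andbT.
  by have [->|] := eqVneq u v; rewrite ?eqxx ?irr ?andbT.
rewrite nal (_ : fib _ _ = [set v]) ?cards1 //; apply/setP => u; by rewrite !inE.
Qed.

(** Starting from [G] itself, contraction is repeated while some plain vertex has at least [n]
    mates; each round removes [n] vertices. *)
Lemma expands_sparse k n al G : 0 < n -> al != 0 -> good G -> cont G al = 0 ->
  exists K, expands k n al G K /\ sparse k n K.
Proof.
move=> n0 al0 gG cG.
suff main m K : #|K| = m -> expands k n al G K ->
    exists K', expands k n al G K' /\ sparse k n K'.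
  by apply: main (erefl _) _; apply: expands_refl => //; have [[]] := gG.
elim/ltn_ind: m K => m IH K Km E.
have [sp|/existsNP[v /not_implyP[cv /negP]]] := pselect (sparse k n K); first by exists K.
rewrite -leqNgt => /card_geqP[s [us ss sm]].
have [io [pi E']] := E.
have [[sK iK] _ _] := exp_good_contr E' gG.
have [||K' [EK' cK']] := @expands_contract k n al G K v [set x in s] al0 sK E cv.
- by apply/subsetP => x; rewrite inE; apply: sm.
- by rewrite cardsE (card_uniqP us).
by apply: (IH #|K'| _ K') => //; lia.
Qed.

(* The key only has to determine adjacency of distinct vertices, so interchangeable vertices may
   share a key; then counting keys and colours suffices to build an isomorphism. *)
Lemma expands_key k n al G K K' (io : K -> G) (pi : G -> K) (io' : K' -> G) (pi' : G -> K')
    (Y : eqType) (key : G -> Y) :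
  expansion k n al io pi -> expansion k n al io' pi' -> 
  (forall u u' w w', key u = key u' -> key w = key w' -> u != w -> u' != w' ->
     edge u w = edge u' w') ->
  (forall y j, #|[set v : K | (key (io v) == y) && (colr v == j)]| =
     #|[set v : K' | (key (io' v) == y) && (colr v == j)]|) ->
  giso K K'.
Proof.
move=> E E' keyE cnt.
have [[y j]|h [h_bij hE]] := @fiber_bij K K' _ (fun v => (key (io v), colr v))
    (fun v => (key (io' v), colr v)).
  transitivity #|[set v : K | (key (io v) == y) && (colr v == j)]|.
    by apply: eq_card => v; rewrite !inE.
  by rewrite cnt; apply: eq_card => v; rewrite !inE.
have keyh v : key (io' (h v)) = key (io v) by case: (hE v).
exists h; split=> // [u v|u]; last by case: (hE u).
have [->|nuv] := eqVneq u v; first by rewrite (exp_irr E) (exp_irr E').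
rewrite -(exp_edge_io E) -(exp_edge_io E'); apply: keyE => //.
  by rewrite (can_eq (exp_ioK E')) (bij_eq h_bij).
by rewrite (can_eq (exp_ioK E)).
Qed.

(** The key is the closed neighbourhood in [G]. By sparsity at most [n] plain vertices of the
    contraction share a key, so the numbers of plain and of [al]-vertices are the remainder and the
    quotient of the plain class size in [G] by [n.+1]. *)
Lemma expands_sib_unique n al G K K' : al != 0 -> simple_graph (@edge G) ->
  expands true n al G K -> expands true n al G K' ->
  sparse true n K -> sparse true n K' -> giso K K'.
Proof.
move=> al0 [s i] [io [pi E]] [io' [pi' E']] sp sp'.
pose N (u : G) : {set G} := [set y | (y == u) || edge u y].
apply: (expands_key (key := N) E E') => [u u' w w' Nu Nw uw uw'|y j].
  have inN x z : x != z -> edge x z = (z \in N x) by rewrite inE eq_sym => /negbTE->.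
  rewrite inN // Nu inE eq_sym s.
  have -> : (u' == w) || edge w u' = (u' \in N w) by rewrite inE.
  by rewrite Nw inE (negbTE uw') s.
have cntE (L : cgraph) (jo : L -> G) (qi : G -> L) j' : expansion true n al jo qi ->
    #|[set u | (N u == y) && (colr u == j')]| =
    if j' == 0 then #|[set v | (N (jo v) == y) && (colr v == 0)]|
                   + n.+1 * #|[set v | (N (jo v) == y) && (colr v == al)]|
    else if j' == al then 0 else #|[set v | (N (jo v) == y) && (colr v == j')]|.
  move=> F; rewrite -(exp_count F al0 (fun v => N (jo v) == y)).
  apply: eq_card => u; rewrite !inE; congr (_ && _); congr (_ == _).
  (* A non-main vertex is a sibling of its main vertex, so [N] is constant on blocks. *)
  have [/eqP<- //|mu] := boolP (main jo qi u); apply/setP => z; rewrite !inE.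
  rewrite (edge_nonmain F) //; case: (eqVneq z u) => //= ->.
  by rewrite s (edge_to_main F) mu orbT.
have small (L : cgraph) (jo : L -> G) (qi : G -> L) : expansion true n al jo qi ->
    sparse true n L -> #|[set v | (N (jo v) == y) && (colr v == 0)]| < n.+1.
  move=> F spL; have joK := exp_ioK F.
  case: (set_0Vmem [set v | (N (jo v) == y) && (colr v == 0)]) => [->|[v]].
    by rewrite cards0.
  rewrite inE => /andP[/eqP Nv /eqP cv]; apply: leq_ltn_trans (_ : #|v |: mates true v| < _).
    apply/subset_leq_card/subsetP => w; rewrite !inE => /andP[/eqP Nw ->].
    case: eqVneq => //= nwv; rewrite /attached nwv; apply/forallP => z; apply/eqP.
    have [->|nzw] := eqVneq z w; first by rewrite (exp_irr F).
    have : (jo z \in N (jo w)) = (jo z \in N (jo v)) by rewrite Nw Nv.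
    by rewrite !inE !(can_eq joK) !(exp_edge_io F) (negbTE nzw).
  rewrite cardsU1; have := spL _ cv; case: (_ \notin _); lia.
have e0 := cntE _ _ _ 0 E; rewrite (cntE _ _ _ 0 E') /= in e0.
have lt1 := small _ _ _ E sp; have lt2 := small _ _ _ E' sp'.
(* Uniqueness of Euclidean division by [n.+1]. *)
have eab : forall a a' b b', a' + n.+1 * b' = a + n.+1 * b -> a < n.+1 -> a' < n.+1 ->
    a = a' /\ b = b'.
  move=> a a' b b' H la la'.
  have ab : b = b'.
    have := congr1 (fun x => x %/ n.+1) H.
    by rewrite /= ![_ + n.+1 * _]addnC ![n.+1 * _]mulnC !divnMDl // !divn_small // !addn0.
  by subst b'; lia.
have [ea eb] := eab _ _ _ _ e0 lt1 lt2.
have [->|j0] := eqVneq j 0; first exact: ea.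
have [->|ja] := eqVneq j al; first exact: eb.
have := cntE _ _ _ j E; rewrite (cntE _ _ _ j E').
by rewrite (negbTE j0) (negbTE ja).
Qed.

(** * Uniqueness of the leaf contraction *)

Definition nbrs G (u : G) : {set G} := [set y | edge u y].

Definition leaf0 G (u : G) : bool := (colr u == 0) && (#|nbrs u| == 1).

Definition leaves_nonadjacent G : Prop :=
  forall u w : G, leaf0 u -> leaf0 w -> ~~ edge u w.

Lemma connected_closed (T : finType) (e : rel T) (A : {set T}) u :
  (forall x y : T, connect e x y) -> u \in A ->
  (forall x y, x \in A -> e x y -> y \in A) -> A = [set: T].
Proof.
move=> c uA clA; apply/setP => v; rewrite inE.
have /connectP[p] := c u v; elim: p u uA => [u uA _ -> //|z p IH u uA] /= /andP[uz zp] vE.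
by apply: IH zp vE; apply: clA uz.
Qed.

(* Adjacent leaves span a component, so the whole graph would be an uncoloured [K_2]. *)
Lemma good_leaves_nonadjacent G : good G -> cont G <> (fun k => 2 * (k == 0)) ->
  leaves_nonadjacent G.
Proof.
move=> [[s i] [_ c] _] nK2 u w /andP[cu lu] /andP[cw lw]; apply/negP => uw; apply: nK2.
have leafE (x y z : G) : #|nbrs x| == 1 -> edge x y -> edge x z -> z = y.
  move=> /cards1P[t Nx] xy xz.
  have : y \in nbrs x by rewrite inE.
  have : z \in nbrs x by rewrite inE.
  by rewrite Nx !inE => /eqP-> /eqP.
have nuw : u != w by apply/eqP => E; rewrite E i in uw.
have GE : [set u; w] = [set: G].
  apply: (connected_closed (u := u) c); rewrite ?inE ?eqxx // => x y; rewrite !inE.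
  case/orP=> /eqP-> xy; first by rewrite (leafE _ _ _ lu uw xy) eqxx orbT.
  by rewrite s in uw; rewrite (leafE _ _ _ lw uw xy) eqxx.
have c0 (v : G) : colr v == 0.
  have : v \in [set u; w] by rewrite GE inE.
  by rewrite !inE => /orP[] /eqP->.
apply/funext => -[|k]; rewrite /cont.
  rewrite (_ : [set _ | _] = [set: G]) -?GE ?cards2 ?nuw //.
  by apply/setP => v; rewrite GE !inE c0.
rewrite (_ : [set _ | _] = set0) ?cards0 //.
by apply/setP => v; rewrite !inE (eqP (c0 v)).
Qed.

Section LeafExpansion.
Variables (n al : nat) (G K : cgraph) (io : K -> G) (pi : G -> K).
Hypotheses (E : expansion false n al io pi) (al0 : al != 0) (n0 : 0 < n).
Hypothesis lf : leaves_nonadjacent G.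
Let ioK := exp_ioK E.

Lemma nonmain_col u : ~~ main io pi u -> colr (pi u) = al.
Proof. by apply: contraNeq => /(main_nonal E). Qed.

Lemma nonmain_nbrs u : ~~ main io pi u -> nbrs u = [set io (pi u)].
Proof. by move=> mu; apply/setP => y; rewrite !inE (edge_nonmain E). Qed.

Lemma nonmain_leaf u : ~~ main io pi u -> leaf0 u.
Proof.
by move=> mu; rewrite /leaf0 (nonmain_nbrs mu) cards1 (exp_col E) (nonmain_col mu) eqxx.
Qed.

Lemma exists_nonmain v : colr v = al -> exists2 u, ~~ main io pi u & pi u = v.
Proof.
move=> cv; have := exp_fib_main v false E; rewrite cv eqxx => c.
have /card_gt0P[u] : 0 < #|[set u | (pi u, main io pi u) == (v, false)]| by rewrite c.
by rewrite inE xpair_eqE eqbF_neg => /andP[/eqP uv mu]; exists u.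
Qed.

(** [z] is the centre of a star that comes from an [al]-vertex. *)
Definition expanded z := main io pi z && (colr (pi z) == al).

(** The centre is adjacent to a new leaf, and leaves are pairwise nonadjacent. *)
Lemma expanded_core z : expanded z -> ~~ leaf0 z /\ colr z = 0.
Proof.
move=> /andP[/eqP mz /eqP cz]; rewrite (exp_col E) cz eqxx; split=> //.
have [u mu uz] := exists_nonmain cz; apply/negP => lz.
have := lf (nonmain_leaf mu) lz; rewrite mz -uz.
by rewrite (edge_to_main E) mu.
Qed.

Lemma leaf_io_col v : leaf0 (io v) -> colr v = 0.
Proof.
move=> lv; have [cv|ncv] := eqVneq (colr v) al.
  have [] := @expanded_core (io v); last by rewrite lv.
  by rewrite /expanded (main_io E) ioK cv eqxx.
by have /andP[/eqP] := lv; rewrite (exp_col E) ioK (negbTE ncv).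
Qed.

Definition own_leaves z : nat := #|[set v | leaf0 (io v) & nbrs (io v) == [set z]]|.

(** The plain leaves at [z] are either main vertices or new leaves; an expanded centre has exactly
    [n] new ones, any other vertex none. *)
Lemma leaves_split z :
  #|[set u | leaf0 u & nbrs u == [set z]]| = own_leaves z + n * expanded z.
Proof.
rewrite -(cardsID [set u | main io pi u]); congr (_ + _).
  rewrite /own_leaves -(card_imset _ (can_inj ioK)); apply: eq_card => u.
  apply/idP/imsetP; rewrite !inE.
    by move=> /andP[lu /eqP mu]; exists (pi u); rewrite // inE -mu.
  by case=> v; rewrite inE => lv ->; rewrite lv (main_io E).
have := exp_fib_main (pi z) false E; rewrite /expanded.
case: (boolP (main io pi z && _)) => [/andP[/eqP mz cz]|nz].
  rewrite cz muln1 => <-; apply: eq_card => u; rewrite !inE xpair_eqE eqbF_neg andbC.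
  case: (boolP (main io pi u)) => [|mu]; rewrite ?andbF // andbT (nonmain_leaf mu) nonmain_nbrs //=.
  rewrite (inj_eq set1_inj) andbT; apply/eqP/eqP => [<-|->]; [by rewrite ioK|by rewrite -mz].
move=> _; rewrite muln0; apply/eqP; rewrite cards_eq0; apply/eqP/setP => u; rewrite !inE.
apply/negP => /and3P[mu lu]; rewrite nonmain_nbrs // (inj_eq set1_inj) => /eqP uz.
by move: nz; rewrite -uz (main_io E) ioK (nonmain_col mu) eqxx.
Qed.

Lemma own_leaves_sparse z : sparse false n K -> main io pi z -> ~~ expanded z ->
  colr z = 0 -> own_leaves z < n.
Proof.
move=> sp mz; rewrite /expanded mz /= => nz cz.
have cpz : colr (pi z) = 0 by rewrite -cz (exp_col E) (negbTE nz).
apply: leq_ltn_trans (sp _ cpz); apply/subset_leq_card/subsetP => v; rewrite !inE.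
move=> /andP[lv /eqP Nv]; rewrite (leaf_io_col lv) /= /attached.
have vE y : edge v y = (y == pi z).
  have : (io y \in nbrs (io v)) = (io y \in [set z]) by rewrite Nv.
  by rewrite !inE (exp_edge_io E) (eqP mz) (can_eq ioK) ioK.
rewrite -[v == _]vE (exp_irr E) /=; apply/forallP => y; by rewrite vE.
Qed.
End LeafExpansion.

(** [G] alone determines the contraction: a plain vertex other than a leaf is expanded exactly if at
    least [n] plain leaves hang from it, for otherwise sparsity leaves it fewer than [n]. *)
Lemma expands_leaf_unique n al G K K' : al != 0 -> 0 < n -> simple_graph (@edge G) ->
  leaves_nonadjacent G -> expands false n al G K -> expands false n al G K' ->
  sparse false n K -> sparse false n K' -> giso K K'.
Proof.
move=> al0 n0 [s i] lf [io [pi E]] [io' [pi' E']] sp sp'.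
have expd_sub (L M : cgraph) (jo : L -> G) (qi : G -> L) (jo' : M -> G) (qi' : G -> M) z :
    expansion false n al jo qi -> expansion false n al jo' qi' ->
    sparse false n M -> expanded al jo qi z -> expanded al jo' qi' z.
  move=> F F' spM ez; apply: contraT => nz.
  have [nlz cz] := expanded_core F n0 lf ez.
  have mz : main jo' qi' z by apply: contraNT nlz => /(nonmain_leaf F').
  have := own_leaves_sparse F' n0 lf spM mz nz cz.
  have := leaves_split F z; rewrite (leaves_split F').
  by rewrite ez (negbTE nz) muln0 muln1; lia.
have expdE z : expanded al io pi z = expanded al io' pi' z.
  by apply/idP/idP; apply: expd_sub.
have ownE z : own_leaves io z = own_leaves io' z.
  have := leaves_split E z; rewrite (leaves_split E') expdE; lia.
(* Leaves at the same vertex are interchangeable and share a key; any other vertex has a key of its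
   own. The Boolean separates the leaves from the vertex they hang from. *)
pose key (u : G) := if leaf0 u then (nbrs u, true) else ([set u], false).
apply: (expands_key (key := key) E E') => [u u' w w'|[Z b] j].
  have inN (x z : G) : edge x z = (z \in nbrs x) by rewrite inE.
  rewrite /key; case: (boolP (leaf0 u)); case: (boolP (leaf0 u')) => // lu' lu [];
    case: (boolP (leaf0 w)); case: (boolP (leaf0 w')) => // lw' lw.
  - by move=> _ [_] _ _; rewrite (negbTE (lf _ _ lu lw)) (negbTE (lf _ _ lu' lw')).
  - by move=> Nu [/set1_inj->] _ _; rewrite !inN Nu.
  - by move=> /set1_inj-> [Nw] _ _; rewrite s inN Nw -inN s.
  - by move=> /set1_inj-> [/set1_inj->].
have [[z ->]|nZ] := pselect (exists z, Z = [set z]); last first.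
  have no (L : cgraph) (jo : L -> G) : #|[set v | (key (jo v) == (Z, b)) && (colr v == j)]| = 0.
    apply/eqP; rewrite cards_eq0; apply/eqP/setP => v; rewrite !inE /key.
    apply/negP => /andP[]; case: ifP => [/andP[_ /cards1P[x Nx]]|_] /eqP[ZE _] _; apply: nZ.
      by exists x; rewrite -ZE.
    by exists (jo v).
  by rewrite !no.
case: b.
  have cnt (L : cgraph) (jo : L -> G) (qi : G -> L) : expansion false n al jo qi ->
      #|[set v | (key (jo v) == ([set z], true)) && (colr v == j)]| =
      if j == 0 then own_leaves jo z else 0.
    move=> F; case: eqP => [->|j0].
      apply: eq_card => v; rewrite !inE /key; case: (boolP (leaf0 _)) => [lv|_].
        by rewrite (leaf_io_col F n0 lf lv) eqxx andbT xpair_eqE eqxx andbT.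
      by rewrite xpair_eqE andbF.
    apply/eqP; rewrite cards_eq0; apply/eqP/setP => v; rewrite !inE /key.
    case: (boolP (leaf0 _)) => [lv|_]; last by rewrite xpair_eqE andbF.
    by rewrite (leaf_io_col F n0 lf lv) [0 == j]eq_sym (introF eqP j0) andbF.
  by rewrite (cnt _ _ _ E) (cnt _ _ _ E') ownE.
have cnt (L : cgraph) (jo : L -> G) (qi : G -> L) : expansion false n al jo qi ->
    #|[set v | (key (jo v) == ([set z], false)) && (colr v == j)]| =
    (~~ leaf0 z && (j == if expanded al jo qi z then al else colr z)).
  move=> F; have joK := exp_ioK F.
  have colE : main jo qi z -> colr (qi z) = if expanded al jo qi z then al else colr z.
    move=> mz; rewrite /expanded mz /= (exp_col F).
    by case: eqP => // ->.
  case: (boolP (leaf0 z)) => [lz|nlz] /=.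
    apply/eqP; rewrite cards_eq0; apply/eqP/setP => v; rewrite !inE /key.
    case: ifP => [_|lv]; first by rewrite xpair_eqE andbF.
    rewrite xpair_eqE (inj_eq set1_inj) andbT; case: eqP => // vz.
    by rewrite vz lz in lv.
  have mz : main jo qi z by apply: contraNT nlz => /(nonmain_leaf F).
  rewrite -colE // eq_sym; case: eqP => [<-|nj].
    rewrite (_ : [set _ | _] = [set qi z]) ?cards1 //; apply/setP => v; rewrite !inE /key.
    have [->|nv] := eqVneq v (qi z); first by rewrite -(eqP mz) (negbTE nlz) !eqxx.
    case: ifP => _; rewrite xpair_eqE ?andbF // (inj_eq set1_inj) andbT.
    by rewrite {1}(eqP mz) (can_eq joK) (negbTE nv).
  apply/eqP; rewrite cards_eq0; apply/eqP/setP => v; rewrite !inE /key.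
  case: ifP => _; rewrite xpair_eqE ?andbF // (inj_eq set1_inj) andbT.
  rewrite {1}(eqP mz) (can_eq joK); case: eqP => //= ->.
  by case: eqP.
by rewrite (cnt _ _ _ E) (cnt _ _ _ E') expdE.
Qed.

(** New leaves hang only from [al]-vertices, so plain siblings in [K] remain siblings. An expanded
    centre does not become a sibling of [io w], because its new leaf tells them apart. *)
Lemma expands_leaf_mates n al G K (io : K -> G) (pi : G -> K) w :
  expansion false n al io pi -> 0 < n -> al != 0 -> symmetric (@edge G) ->
  colr w = 0 -> mates true (io w) = io @: mates true w.
Proof.
move=> E n0 al0 s cw; have ioK := exp_ioK E.
have nonmainE y v : ~~ main io pi y -> edge (io v) y = (v == pi y).
  by move=> my; rewrite s (edge_nonmain E) //= (can_eq ioK).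
have col_io v : colr v = 0 -> colr (io v) = 0.
  by move=> cv; rewrite (exp_col E) ioK cv; case: ifP.
apply/setP => u; apply/idP/imsetP; last first.
  case=> v; rewrite !inE => /andP[/eqP cv /andP[vw /forallP av]] ->.
  rewrite col_io // eqxx /attached (can_eq ioK) vw; apply/forallP => y.
  have [/eqP->|my] := boolP (main io pi y).
    by rewrite !(exp_edge_io E) !(can_eq ioK).
  have cy := nonmain_col E my.
  have ny x : colr x = 0 -> (x == pi y) = false.
    by move=> cx; apply: contraNF al0 => /eqP xy; rewrite -cy -xy cx.
  have yw : (y == io w) = false by apply: contraNF my => /eqP->; apply: (main_io E).
  by rewrite !nonmainE // !ny // yw andbF.
rewrite inE => /andP[/eqP cu /andP[uw /forallP au]].
have uiw : edge u (io w) by rewrite (eqP (au _)) eq_sym uw eqxx.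
have mu : main io pi u.
  apply: contraT => mu; move: uiw; rewrite s nonmainE // => /eqP wu.
  by move: al0; rewrite -(nonmain_col E mu) -wu cw.
have cpu : colr (pi u) = 0.
  have [cv|] := eqVneq (colr (pi u)) al; last first.
    by move=> ncv; rewrite -cu (exp_col E) (negbTE ncv).
  have [x mx xu] := exists_nonmain E n0 cv.
  have := au x; rewrite (eqP mu) !nonmainE // -xu eqxx => /eqP/esym/andP[_ /orP[/eqP xw|/eqP wx]].
    by rewrite xw (main_io E) in mx.
  by case/eqP: uw; rewrite (eqP mu) -xu -wx.
exists (pi u); last exact/eqP.
rewrite inE cpu eqxx /attached; move: uw; rewrite {1}(eqP mu) (can_eq ioK) => -> /=.
apply/forallP => y; have := au (io y).
by rewrite (eqP mu) !(exp_edge_io E) !(can_eq ioK) ioK.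
Qed.

(** The plain vertices of [G] that do not come from plain vertices of [K] are the expanded centres
    and their new leaves. These have no mates: a mate of either would turn the centre into a
    leaf. *)
Lemma expands_leaf_sparse n n' al G K : 0 < n -> 0 < n' -> al != 0 ->
  simple_graph (@edge G) -> leaves_nonadjacent G -> expands false n al G K ->
  (sparse true n' G <-> sparse true n' K).
Proof.
move=> n0 n0' al0 [s i] lf [io [pi E]]; have ioK := exp_ioK E.
have matesE w : colr w = 0 -> #|mates true (io w)| = #|mates true w|.
  by move=> cw; rewrite (expands_leaf_mates E) // (card_imset _ (can_inj ioK)).
split=> sp w cw.
  by rewrite -matesE // sp // (exp_col E) ioK cw; case: ifP.
have attE x y : attached true x w -> edge x y = (y != x) && ((y == w) || edge w y).
  by case/andP=> _ /forallP/(_ y)/eqP.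
have no_leaf x : colr x = 0 -> attached true x w -> nbrs x = [set w] -> leaf0 x.
  by move=> cx _ Nx; rewrite /leaf0 cx Nx cards1.
suff [[v -> cv]|m0] : (exists2 v, w = io v & colr v = 0) \/ mates true w = set0.
  by rewrite matesE // sp.
  by rewrite m0 cards0.
have [mw|mw] := boolP (main io pi w).
  have [cv|ncv] := eqVneq (colr (pi w)) al; last first.
    by left; exists (pi w); [exact/eqP|rewrite -cw (exp_col E) (negbTE ncv)].
  right; apply/setP => x; rewrite !inE; apply/negP => /andP[/eqP cx axw].
  have [z mz zw] := exists_nonmain E n0 cv.
  have wz : edge w z by rewrite s (edge_nonmain E) //= zw.
  have zx : z = x.
    apply/eqP; apply: contraT => nzx.
    have : edge x z by rewrite attE // nzx wz orbT.
    rewrite s (edge_nonmain E) //= zw -(eqP mw) => /eqP xw.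
    by case/andP: axw; rewrite xw eqxx.
  have [nl _] : ~~ leaf0 w /\ colr w = 0.
    by apply: (expanded_core E n0 lf); rewrite /expanded mw cv eqxx.
  case/negP: nl; rewrite /leaf0 cw eqxx /=; apply/cards1P; exists x; apply/setP => y; rewrite !inE.
  apply/idP/eqP => [wy|->]; last by rewrite -zx.
  apply/eqP; apply: contraT => nyx.
  have : edge x y by rewrite attE // nyx wy orbT.
  by rewrite -zx (edge_nonmain E) //= zw -(eqP mw) => /eqP yw; rewrite yw i in wy.
right; apply/setP => x; rewrite !inE; apply/negP => /andP[/eqP cx axw].
have xw : edge x w by rewrite attE // eqxx andbT eq_sym; case/andP: axw.
have xE : x = io (pi w) by move: xw; rewrite s (edge_nonmain E) //= => /eqP.
have [nl _] : ~~ leaf0 x /\ colr x = 0.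
  by apply: (expanded_core E n0 lf); rewrite xE /expanded (main_io E) ioK (nonmain_col E mw) eqxx.
case/negP: nl; rewrite /leaf0 cx eqxx /=; apply/cards1P; exists w; apply/setP => y; rewrite !inE.
apply/idP/eqP => [xy|->] //.
move: (xy); rewrite attE // => /andP[nyx /orP[/eqP //|]].
by rewrite (edge_nonmain E) //= -xE (negbTE nyx).
Qed.

(** Contraction of one kind as a bijection of classes. [J] is a property carried along and [Q]
    constrains the content, so that the sibling step and the leaf step can be chained. *)
Lemma expands_equin k n al (J : cgraph -> Prop) (Q : (nat -> nat) -> Prop) :
  0 < n -> al != 0 -> (forall c, Q c -> c al = 0) ->
  (forall G K, good G -> Q (cont G) -> expands k n al G K -> (J G <-> J K)) ->
  (forall G K K', good G -> Q (cont G) -> expands k n al G K -> expands k n al G K' ->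
     sparse k n K -> sparse k n K' -> giso K K') ->
  equin giso (fun G => [/\ good G, J G & Q (cont G)])
    (fun K => [/\ good K, J K, sparse k n K & Q (expand_cont al n (cont K))]).
Proof.
move=> n0 al0 Qal JE uniqK.
have contE G K : expands k n al G K -> cont G = expand_cont al n (cont K).
  by case=> io [pi E]; apply: exp_cont E al0.
exists (expands k n al); split.
- move=> G [gG JG QG]; have [K [GK spK]] := expands_sparse k n0 al0 gG (Qal _ QG).
  exists K => //; split=> //; first by have [io [pi E]] := GK; apply: exp_good_contr E gG.
    by apply/(JE G).
  by rewrite -(contE _ _ GK).
- move=> K [gK JK spK QK]; have [G GK] : exists G, expands k n al G K.
    by apply: expands_exists; have [[]] := gK.
  have gG : good G by have [io [pi E]] := GK; apply: exp_good E gK.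
  have QG : Q (cont G) by rewrite (contE _ _ GK).
  by exists G => //; split=> //; apply/(JE G K).
move=> G G' K K' [gG _ QG] [gG' _ QG'] [gK _ spK _] [gK' _ spK' _] GK GK'; split=> H.
- by apply: (uniqK G') => //; apply: expands_gisoL H GK.
- by apply: expands_uniqueL (expands_gisoR H GK) GK'.
Qed.

(* The content of the uncoloured K_2. *)
Definition uncoloured2 (c : nat -> nat) : Prop := c = fun k => 2 * (k == 0).

(** Siblings are contracted first, then leaves; the second step preserves the sparsity gained in the
    first. *)
Lemma good_equin_bounded a b al be (c : nat -> nat) : al != 0 -> be != 0 -> al != be ->
  c al = 0 -> c be = 0 -> ~ uncoloured2 c ->
  equin giso (fun G => good G /\ cont G = c)
    (fun K => [/\ good K, sparse true a.+1 K, sparse false b.+1 K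
       & expand_cont al a.+1 (expand_cont be b.+1 (cont K)) = c]).
Proof.
move=> al0 be0 albe cal cbe nc.
apply: (@equin_trans _ _ _
  (fun K => [/\ good K, sparse true a.+1 K & expand_cont al a.+1 (cont K) = c])).
  have := @expands_equin true a.+1 al (fun=> True) (fun d => d = c) isT al0.
  case=> [d -> //|//|G K K' [sG _ _] _|r [r1 r2 r3]]; first exact: expands_sib_unique.
  exists r; split.
  - by move=> x [gx cx]; have [//|y [] *] := r1 x; exists y.
  - by move=> y [gy sy cy]; have [//|x [] *] := r2 y; exists x.
  - move=> x x' y y' [? ?] [? ?] [? ? ?] [? ? ?]; exact: r3.
(* The intermediate graph is not an uncoloured [K_2] either: lacking [al]-vertices, it would have
   the same content as its expansion. *)
have eQ d : expand_cont al a.+1 d = c -> d be = 0 /\ ~ uncoloured2 d.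
  move=> dc; split.
    by rewrite -cbe -dc /expand_cont (negbTE be0) eq_sym (negbTE albe).
  move=> d2; apply: nc; rewrite /uncoloured2 -dc d2; apply/funext => j.
  rewrite /expand_cont; case: (eqVneq j 0) => _; first by rewrite (negbTE al0) !muln0 addn0.
  by rewrite muln0; case: ifP.
have := @expands_equin false b.+1 be (sparse true a.+1) (fun d => expand_cont al a.+1 d = c) isT be0.
case=> [d /eQ[] //|G K gG /eQ[_ nG] GK|G K K' gG /eQ[_ nG]|r [r1 r2 r3]].
- apply: expands_leaf_sparse GK => //; first by case: gG.
  exact: good_leaves_nonadjacent.
- apply: expands_leaf_unique => //; first by case: gG.
  exact: good_leaves_nonadjacent.
exists r; split.
- by move=> x xP; have [//|y [] *] := r1 x; exists y.
- by move=> y [? ? ? ?]; have [//|x [] *] := r2 y; exists x.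
- move=> x x' y y' ? ? [? ? ? ?] [? ? ? ?]; exact: r3.
Qed.

(** * Symmetry of the cumulative counts *)

Lemma giso_ord G m : #|G| = m -> exists (f : G -> 'I_m) g, cancel f g /\ cancel g f.
Proof.
move=> cG; exists (fun v => cast_ord cG (enum_rank v)).
exists (fun i => enum_val (cast_ord (esym cG) i)).
by split=> x; rewrite ?cast_ordK ?cast_ordKV ?enum_rankK ?enum_valK ?cast_ordKV.
Qed.

(** Up to isomorphism the vertex set is ['I_n] and the colours form a finite set. *)
Lemma cont_ncls (c : nat -> nat) B : (forall k, B <= k -> c k = 0) ->
  exists n, ncls giso (fun G => cont G = c) n.
Proof.
move=> cB; pose n := \sum_(k < B.+1) c k.
pose F (x : {ffun 'I_n * 'I_n -> bool} * {ffun 'I_n -> 'I_B.+1}) : cgraph :=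
  CGraph (fun i j => x.1 (i, j)) (fun i => x.2 i : nat).
apply: (ncls_finite giso_refl giso_sym giso_trans (f := F)) => G cG.
have ltB (v : G) : colr v < B.+1.
  rewrite ltnS leqNgt; apply/negP => /ltnW /cB; rewrite -cG => /eqP.
  by rewrite cards_eq0 => /eqP/setP/(_ v); rewrite !inE eqxx.
have card_G : #|G| = n.
  rewrite -sum1_card (partition_big (fun v => inord (colr v) : 'I_B.+1) xpredT) //=.
  apply: eq_bigr => k _; rewrite -cG /cont -sum1_card; apply: eq_bigl => v.
  by rewrite inE -val_eqE /= inordK.
have [f [g [fK gK]]] := giso_ord card_G.
exists ([ffun p => edge (g p.1) (g p.2)], [ffun i => inord (colr (g i))]), f; split.
- by exists g.
- by move=> u v; rewrite /= ffunE /= !fK.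
- by move=> u; rewrite /= ffunE fK inordK.
Qed.

Lemma expand_contC al be a b d : al != 0 -> be != 0 -> al != be ->
  expand_cont al a (expand_cont be b d) = expand_cont be b (expand_cont al a d).
Proof.
move=> al0 be0 albe; apply/funext => j; rewrite /expand_cont !eqxx.
rewrite !(negbTE al0) !(negbTE be0) [be == al]eq_sym (negbTE albe).
by do !case: ifP => //; lia.
Qed.

Lemma equin0 (P Q : cgraph -> Prop) :
  (forall G, ~ P G) -> (forall G, ~ Q G) -> equin giso P Q.
Proof. by move=> P0 Q0; exists (fun _ _ => True); split=> [G /P0|G /Q0|G ? ? ? /P0]. Qed.

Definition bounded (a b : nat) G : Prop :=
  [/\ good G, sparse true a.+1 G & sparse false b.+1 G].

(** Both [P] and [Q] are equinumerous with the good graphs of content [c]. Sorted by their own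
    content, all parts except that of content [c] correspond by induction, hence so does the
    remaining part by subtraction. *)
Lemma bounded_symmetric a b (c : nat -> nat) B : (forall k, B <= k -> c k = 0) ->
  ~ uncoloured2 c ->
  equin giso (fun G => bounded a b G /\ cont G = c) (fun G => bounded b a G /\ cont G = c).
Proof.
move: {2}(c 0) (erefl (c 0)) => N; elim/ltn_ind: N c B => N IH c B c0 cB nc.
(* Both colours exceed the bound [B] and are therefore fresh. *)
pose al := B.+1; pose be := B.+2.
have [al0 be0] : al != 0 /\ be != 0 by [].
have albe : al != be by rewrite /al /be; lia.
have [cal cbe] : c al = 0 /\ c be = 0 by split; apply: cB; rewrite /al /be; lia.
pose ex d := expand_cont al a.+1 (expand_cont be b.+1 d).
pose P G := bounded a b G /\ ex (cont G) = c.
pose Q G := bounded b a G /\ ex (cont G) = c.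
pose T G := good G /\ cont G = c.
have TP : equin giso T P.
  have -> : P = (fun K => [/\ good K, sparse true a.+1 K, sparse false b.+1 K & ex (cont K) = c]).
    by apply/funext => G; apply/propext; split=> [[[]]|[]].
  exact: good_equin_bounded.
(* Now [be] marks merged siblings and [al] deleted leaves, each with its former weight. *)
have TQ : equin giso T Q.
  have -> : Q = (fun K => [/\ good K, sparse true b.+1 K, sparse false a.+1 K
      & expand_cont be b.+1 (expand_cont al a.+1 (cont K)) = c]).
    apply/funext => G; apply/propext; rewrite /Q /ex expand_contC //.
    by split=> [[[]]|[]].
  by apply: good_equin_bounded => //; rewrite eq_sym.
have [n Pn] : exists n, ncls giso P n.
  have [n0 cn] := cont_ncls cB.
  have [n Tn] : exists n, ncls giso T n.
    by apply: (ncls_sub giso_refl giso_sym giso_trans _ cn) => G [].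
  by exists n; apply: ncls_equin TP Tn.
have exE d j : ex d j = if j == 0 then d 0 + b.+2 * d be + a.+2 * d al
    else if (j == al) || (j == be) then 0 else d j.
  rewrite /ex /expand_cont (negbTE al0) (negbTE albe) eqxx.
  by case: eqP => //= _; case: eqP.
have exc : ex c = c.
  apply/funext => j; rewrite exE cal cbe !muln0 !addn0.
  by case: eqP => [->|_] //; case: (eqVneq j al) => [->|_] //=; case: eqP => [->|].
have main : equin giso (fun G => P G /\ cont G = c) (fun G => Q G /\ cont G = c).
  apply: (equin_index giso_refl giso_sym giso_trans _ _ Pn) => [G K /giso_cont //|G K /giso_cont //||c' nc'].
    exact: equin_trans (equin_sym TP) TQ.
  have [ec'|nec'] := pselect (ex c' = c); last first.
    by apply: equin0 => G [[_ eG] cG]; apply: nec'; rewrite -cG.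
  (* Without [al]- and [be]-vertices [ex] changes nothing, so [c'] would equal [c]. *)
  have new : ~ (c' al = 0 /\ c' be = 0).
    case=> a0 b0; apply: nc'; rewrite -ec'; apply/funext => j.
    rewrite exE a0 b0 !muln0 !addn0.
    by case: eqP => [->|_] //; case: (eqVneq j al) => [->|_] //=; case: eqP => [->|].
  have RE x y : (fun G => (bounded x y G /\ ex (cont G) = c) /\ cont G = c') =
      (fun G => bounded x y G /\ cont G = c').
    apply/funext => G; apply/propext; split=> [[[]]|[bG cG]] //.
    by rewrite cG.
  (* The bound grows to [B.+3] because [c'] may use [al] and [be]. *)
  rewrite /P /Q !RE; apply: (IH (c' 0) _ c' B.+3) => //.
  - have : 0 < c' al + c' be.
      by rewrite lt0n addn_eq0; apply/negP => /andP[/eqP ? /eqP ?]; apply: new.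
    by rewrite -c0 -ec' exE /=; move: (c' 0) (c' al) (c' be); nia.
  - move=> k kB; rewrite -(cB k); last by lia.
    rewrite -ec' exE; have [-> [-> ->]] // : (k == 0) = false /\ (k == al) = false /\ (k == be) = false.
    by rewrite /al /be; do !split; apply/eqP; lia.
  - by move=> c'2; apply: new; rewrite c'2 /= muln0.
have RE x y : (fun G => (bounded x y G /\ ex (cont G) = c) /\ cont G = c) =
    (fun G => bounded x y G /\ cont G = c).
  apply/funext => G; apply/propext; split=> [[[]]|[bG cG]] //.
  by rewrite cG exc.
by move: main; rewrite /P /Q !RE.
Qed.

(** * Sibling and tuft numbers *)

Definition uncoloured (m : nat) : nat -> nat := fun k => if k == 0 then m else 0.

Lemma uncoloured_colr m G : cont G = uncoloured m -> forall v : G, colr v = 0.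
Proof.
move=> cG v; apply/eqP; apply: contraT => cv; have := congr1 (fun c => c (colr v)) cG.
rewrite /uncoloured (negbTE cv) => /eqP; rewrite cards_eq0 => /eqP/setP/(_ v).
by rewrite !inE eqxx.
Qed.

Lemma uncoloured_card m G : cont G = uncoloured m -> #|G| = m.
Proof.
move=> cG; rewrite -[m](congr1 (fun c => c 0) cG) /cont -cardsT; apply: eq_card => v.
by rewrite !inE (uncoloured_colr cG).
Qed.

Lemma uncoloured_cont G : (forall v : G, colr v = 0) -> cont G = uncoloured #|G|.
Proof.
move=> c0; apply/funext => k; rewrite /cont /uncoloured -cardsT eq_sym.
case: eqP => [<-|k0]; first by apply: eq_card => v; rewrite !inE c0.
by apply/eqP; rewrite cards_eq0; apply/eqP/setP => v; rewrite !inE c0; apply/eqP.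
Qed.

Notation sib G := (sibling_number (@edge G)).
Notation tuft G := (tuft_number (@edge G)).

(** The class of [v] is [v] together with its mates, which accounts for the [- 1] in the sibling
    number. *)
Lemma sib_leq G a : 0 < #|G| -> symmetric (@edge G) -> irreflexive (@edge G) ->
  (forall v : G, colr v = 0) -> (sib G <= a) <-> sparse true a.+1 G.
Proof.
move=> G0 s i c0.
have clE (v : G) : #|[set u | cnbh edge [set: G] u == cnbh edge [set: G] v]| = #|mates true v|.+1.
  rewrite (cardsD1 v) inE eqxx add1n; congr _.+1; apply: eq_card => u.
  rewrite !inE c0 eqxx /=; congr (_ && _); apply/eqP/forallP => [Nuv y|au].
    have [->|yu] := eqVneq y u; first by rewrite i.
    have := congr1 (fun A : {set G} => y \in A) Nuv.
    by rewrite !inE (negbTE yu) /= => ->.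
  have uv : edge u v || (u == v).
    by rewrite (eqP (au v)) eqxx andbT; case: eqVneq.
  apply/setP => y; rewrite !inE (eqP (au y)); case: (eqVneq y u) => [->|] //=.
  by rewrite s orbC uv.
rewrite /sibling_number /sparse leq_subLR add1n; split=> [/bigmax_leqP le v _|sp].
  by have := le v isT; rewrite clE.
by apply/bigmax_leqP => v _; rewrite clE; apply: sp.
Qed.

Lemma tuft_leq G b : symmetric (@edge G) -> irreflexive (@edge G) ->
  (forall v : G, colr v = 0) -> (tuft G <= b) <-> sparse false b.+1 G.
Proof.
move=> s i c0.
have tE (v : G) : [set u in leaves edge [set: G] | edge u v] = mates false v.
  apply/setP => u; rewrite !inE c0 eqxx /= /attached.
  have -> : [set x in [set: G] | edge u x] = nbrs u by apply/setP => x; rewrite !inE.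
  apply/andP/andP => [[/cards1P[x Nu] uv]|[uv /forallP au]].
    have nE y : edge u y = (y == x).
      have : (y \in nbrs u) = (y \in [set x]) by rewrite Nu.
      by rewrite !inE.
    split; first by apply/eqP => uvE; rewrite uvE i in uv.
    by apply/forallP => y; rewrite nE; move: uv; rewrite nE => /eqP->.
  have -> : nbrs u = [set v] by apply/setP => y; rewrite !inE (eqP (au y)).
  by rewrite cards1 (eqP (au v)) eqxx.
rewrite /tuft_number /sparse; split=> [/bigmax_leqP le v _|sp].
  by have := le v isT; rewrite tE.
by apply/bigmax_leqP => v _; rewrite tE; apply: sp.
Qed.

Lemma eq_of_leq (x y : nat) : (forall a, x <= a <-> y <= a) -> x = y.
Proof.
by move=> H; apply/eqP; rewrite eqn_leq; apply/andP; split; [apply/H|apply/(H x)].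
Qed.

Lemma giso_stat m G K : giso G K -> good G -> cont G = uncoloured m ->
  sib G = sib K /\ tuft G = tuft K.
Proof.
move=> iGK gG cG; have gK := giso_good iGK gG.
have cK : cont K = uncoloured m by rewrite -(giso_cont iGK).
have [[sG iG] [G0 _] _] := gG; have [[sK iK] [K0 _] _] := gK.
have c0 := uncoloured_colr cG; have c0' := uncoloured_colr cK.
split; apply: eq_of_leq => a.
  rewrite !sib_leq //; split; first exact: giso_sparse.
  by apply: giso_sparse; apply: giso_sym.
rewrite !tuft_leq //; split; first exact: giso_sparse.
by apply: giso_sparse; apply: giso_sym.
Qed.

Definition with_stats (m a b : nat) G : Prop :=
  [/\ good G, cont G = uncoloured m & (sib G, tuft G) = (a, b)].

(** A second subtraction, now by induction on [a + b]: the exact count at [(a, b)] is the cumulative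
    count without the smaller pairs. *)
Lemma with_stats_symmetric m a b : m != 2 ->
  equin giso (with_stats m a b) (with_stats m b a).
Proof.
move=> m2; move: {2}(a + b) (erefl (a + b)) => N; elim/ltn_ind: N a b => N IH a b Nab.
have nm : ~ uncoloured2 (uncoloured m).
  by move/(congr1 (fun c => c 0)); rewrite /uncoloured /= => m2'; rewrite m2' in m2.
have cB k : 1 <= k -> uncoloured m k = 0 by case: k.
pose P x y G := bounded x y G /\ cont G = uncoloured m.
have PE x y G : P x y G <-> [/\ good G, cont G = uncoloured m, sib G <= x & tuft G <= y].
  split=> [[[g sp sp'] c]|[g c sx ty]]; have [[s i] [G0 _] _] := g;
    have c0 := uncoloured_colr c; split=> //.
  - by apply/sib_leq.
  - by apply/tuft_leq.
  - by split=> //; [apply/sib_leq|apply/tuft_leq].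
have [n cn] := cont_ncls cB.
have [n' Pn] : exists n, ncls giso (P a b) n.
  by apply: (ncls_sub giso_refl giso_sym giso_trans _ cn) => G [].
(* On the right the two statistics are listed in exchanged order, so that equal indices
   correspond. *)
have main : equin giso (fun G => P a b G /\ (sib G, tuft G) = (a, b))
    (fun G => P b a G /\ (tuft G, sib G) = (a, b)).
  apply: (equin_index giso_refl giso_sym giso_trans _ _ Pn).
  - by move=> G K iGK [[gG _ _] cG] _; have [-> ->] := giso_stat iGK gG cG.
  - by move=> G K iGK [[gG _ _] cG] _; have [-> ->] := giso_stat iGK gG cG.
  - exact: (bounded_symmetric a b cB nm).
  move=> [x y] nxy; have [/andP[xa yb]|nle] := boolP ((x <= a) && (y <= b)); last first.
    by apply: equin0 => G [/PE[_ _ h1 h2] [E1 E2]]; move: nle; rewrite -E1 -E2 ?h1 ?h2.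
  have E1 : (fun G => P a b G /\ (sib G, tuft G) = (x, y)) = with_stats m x y.
    apply/funext => G; apply/propext; split=> [[/PE[g c _ _] st]|[g c [sx ty]]]; first by split.
    by split; [apply/PE; rewrite sx ty|rewrite sx ty].
  have E2 : (fun G => P b a G /\ (tuft G, sib G) = (x, y)) = with_stats m y x.
    apply/funext => G; apply/propext; split=> [[/PE[g c _ _] [<- <-]]|[g c [sx ty]]]; first by split.
    by split; [apply/PE; rewrite sx ty|rewrite sx ty].
  rewrite E1 E2; apply: (IH (x + y)) => //; rewrite -Nab.
  have : (x != a) || (y != b).
    by rewrite -negb_and; apply/negP => /andP[/eqP ex /eqP ey]; apply: nxy; rewrite ex ey.
  by lia.
have E1 : (fun G => P a b G /\ (sib G, tuft G) = (a, b)) = with_stats m a b.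
  apply/funext => G; apply/propext; split=> [[/PE[g c _ _] st]|[g c [sx ty]]]; first by split.
  by split; [apply/PE; rewrite sx ty|rewrite sx ty].
have E2 : (fun G => P b a G /\ (tuft G, sib G) = (a, b)) = with_stats m b a.
  apply/funext => G; apply/propext; split=> [[/PE[g c _ _] [<- <-]]|[g c [sx ty]]]; first by split.
  by split; [apply/PE; rewrite sx ty|rewrite sx ty].
by rewrite -E1 -E2.
Qed.

(** * Passage to labelled graphs *)

Definition of_labgraph m (E : labgraph m) : cgraph := CGraph (adj E) (fun=> 0).

Lemma isomorphicP m (E E' : labgraph m) :
  reflect (giso (of_labgraph E) (of_labgraph E')) (isomorphic E E').
Proof.
apply: (iffP existsP) => [[p /forallP pE]|[f [/bij_inj f_inj fe _]]].
  exists p; split=> //; first by exists (p^-1%g : 'S_m); [apply: permK|apply: permKV].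
  by move=> x y; have /forallP/(_ y)/eqP /esym := pE x.
exists (perm f_inj); apply/forallP => x; apply/forallP => y.
by rewrite !permE; apply/eqP; rewrite -[LHS]/(edge (c := of_labgraph E) x y) -fe.
Qed.

Lemma of_labgraph_stats m a b (E : labgraph m) : with_stats m a b (of_labgraph E) <->
  simple_graph (adj E) /\ connected_graph (adj E) /\ chordal (adj E) /\
  sibling_number (adj E) = a /\ tuft_number (adj E) = b.
Proof.
split=> [[[s c ch] _ [sa tb]]|[s [c [ch [sa tb]]]]]; first by [].
split=> //; last by rewrite /= sa tb.
by rewrite uncoloured_cont // card_ord.
Qed.

Lemma labgraph_exists m G : cont G = uncoloured m -> exists E : labgraph m, giso G (of_labgraph E).
Proof.
move=> cG; have [f [g [fK gK]]] := giso_ord (uncoloured_card cG).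
exists [set p | edge (g p.1) (g p.2)], f; split=> [|u v|u]; first by exists g.
  by rewrite /= /adj inE /= !fK.
by rewrite /= (uncoloured_colr cG).
Qed.

(** One graph chosen from each class in [chordal_classes] gives the transversal. *)
Lemma chordal_classes_ncls m a b : ncls giso (with_stats m a b) #|chordal_classes m a b|.
Proof.
pose cls (E : labgraph m) := [set H | isomorphic E H].
have memP A : A \in chordal_classes m a b <->
    exists2 E, with_stats m a b (of_labgraph E) & A = cls E.
  split=> [/imsetP[E]|[E /of_labgraph_stats sE ->]].
    by rewrite inE => /asboolP/of_labgraph_stats sE ->; exists E.
  by apply/imsetP; exists E => //; rewrite inE; apply/asboolP.
have clsE E E' : giso (of_labgraph E) (of_labgraph E') -> cls E = cls E'.
  move=> iE; apply/setP => H; rewrite !inE; apply/isomorphicP/isomorphicP => H1.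
    exact: giso_trans (giso_sym iE) H1.
  exact: giso_trans iE H1.
pose I : finType := {A | A \in chordal_classes m a b}.
have /choice [g gP] : forall A : I, exists E,
    with_stats m a b (of_labgraph E) /\ val A = cls E.
  by move=> A; have /memP[E] := valP A; exists E.
exists I, (fun A => of_labgraph (g A)); split.
- by rewrite card_sig; apply: eq_card.
- by move=> A; case: (gP A).
- by move=> A A' /clsE E; apply: val_inj; rewrite (gP A).2 (gP A').2.
move=> G [gG cG st]; have [E iE] := labgraph_exists cG.
have sE : with_stats m a b (of_labgraph E).
  have [sG tG] := giso_stat iE gG cG; split; first exact: giso_good gG.
    by rewrite -(giso_cont iE).
  by rewrite -sG -tG.
have clsA : cls E \in chordal_classes m a b by apply/memP; exists E.
pose A : I := exist (fun A => A \in chordal_classes m a b) (cls E) clsA.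
exists A; apply: giso_trans iE _; have [_ /= /setP/(_ (g A))] := gP A.
rewrite !inE => E1; apply/isomorphicP; rewrite E1; apply/isomorphicP; exact: giso_refl.
Qed.

(** On two vertices, being siblings and being a leaf at the other vertex are the same relation. *)
Lemma two_vertices_stat G : good G -> cont G = uncoloured 2 -> sib G = tuft G.
Proof.
move=> [[s i] [G0 _] _] cG; have c0 := uncoloured_colr cG; have cG2 := uncoloured_card cG.
have attE (u v : G) : attached true u v = attached false u v.
  rewrite /attached; have [//|uv] := eqVneq u v; rewrite /=.
  apply: eq_forallb => y; congr (_ == _).
  have : y \in [set u; v].
    have -> : [set u; v] = [set: G]; last by rewrite inE.
    by apply/eqP; rewrite eqEcard subsetT cardsT cG2 cards2 uv.
  by rewrite !inE => /orP[] /eqP->; rewrite eqxx ?(negbTE uv) //= eq_sym uv.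
apply: eq_of_leq => a; rewrite sib_leq // tuft_leq // /sparse.
by split=> sp v cv; rewrite (leq_ltn_trans _ (sp v cv)) //;
  apply/subset_leq_card/subsetP => u; rewrite !inE attE.
Qed.

Theorem theorem7p1 :
  (forall (T : finType) (e : rel T), simple_graph e -> connected_graph e ->
     ~ is_K2 e ->
     forall n : nat, 4 <= n ->
     forall W : {set T}, is_reduction e W ->
       (induced_cycle e [set: T] n <-> induced_cycle e W n))
  /\
  (forall m : nat, 1 <= m -> forall a b : nat,
     #|chordal_classes m a b| = #|chordal_classes m b a|).
Proof.
split=> [T e [s i] _ _ n n4 W [reach _]|m _ a b]; first exact: (red_reach_cycle s i n4).
have sym : equin giso (with_stats m a b) (with_stats m b a).
  (* For [m = 2] both sides are empty unless [a = b]. *)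
  have [m2|] := eqVneq m 2; last exact: with_stats_symmetric.
  have [->|nab] := eqVneq a b; first exact: (equin_refl giso_refl giso_sym giso_trans).
  have st_eq x y G : with_stats m x y G -> x = y.
    by rewrite m2 => -[gG cG [<- <-]]; apply: two_vertices_stat.
  by apply: equin0 => G /st_eq ab; rewrite ab eqxx in nab.
apply: (ncls_unique giso_sym giso_trans) (chordal_classes_ncls m b a).
exact: ncls_equin sym (chordal_classes_ncls m a b).
Qed.
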